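(* Let $\alpha>1/2$, let $1\ge\gamma_1\ge\gamma_2\ge\cdots>0$ be a sequence of product weights, and let $\delta\in(0,1)$ be fixed. For $d\in\mathbb{N}$ and an admissible budget $M_{\max}$, run the median lattice-based algorithm with parameters $\tau=\tau_*$, $N=N_{\max}$ and $R$ determined from $M_{\max}$ by the budget-based parameter choice, and let $M=RN$ be its number of function evaluations. Then for every $d$ and every $\varepsilon>0$, $$\sup_{\substack{f\in\mathcal{H}_{d,\alpha,\boldsymbol{\gamma}}\\ \|f\|_{d,\alpha,\boldsymbol{\gamma}}\le1}}\Big(\mathbb{E}\,\|f-A^{\mathrm{rand}}(f)\|_{L_2}^2\Big)^{1/2}=O(M^{-\alpha+\varepsilon}),$$ i.e. there is a constant $C_{d,\varepsilon}$ such that the left-hand side is at most $C_{d,\varepsilon}M^{-\alpha+\varepsilon}$ for all admissible $M_{\max}$. Moreover, the implied factor $C_{d,\varepsilon}$ can be chosen independent of $d$ if $\sum_{j=1}^\infty\gamma_j^{1/(2\alpha)}<\infty$, and can be chosen to depend only polynomially on $d$ (for fixed $\varepsilon$) if $\limsup_{d\to\infty}\big(\sum_{j=1}^d\gamma_j^{1/(2\alpha)}\big)/\log d<\infty$.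
   Context: **Korobov space.** For $\boldsymbol{h}\in\mathbb{Z}^d$ put $r_{2\alpha,\boldsymbol{\gamma}}(\boldsymbol{h})=\prod_{j=1}^d\max\{|h_j|^{2\alpha}/\gamma_j,1\}$. The weighted Korobov space $\mathcal{H}_{d,\alpha,\boldsymbol{\gamma}}$ is the Hilbert space of (complex-valued) functions $f$ on $[0,1]^d$, one-periodic in each variable and equal pointwise to their absolutely convergent Fourier series $f(\boldsymbol{x})=\sum_{\boldsymbol{h}\in\mathbb{Z}^d}\widehat f(\boldsymbol{h})\exp(2\pi \mathrm{i}\,\boldsymbol{h}\cdot\boldsymbol{x})$, where $\widehat f(\boldsymbol{h})=\int_{[0,1]^d}f(\boldsymbol{x})\exp(-2\pi \mathrm{i}\,\boldsymbol{h}\cdot\boldsymbol{x})\,d\boldsymbol{x}$, with finite norm $\|f\|_{d,\alpha,\boldsymbol{\gamma}}=\big(\sum_{\boldsymbol{h}\in\mathbb{Z}^d}|\widehat f(\boldsymbol{h})|^2r_{2\alpha,\boldsymbol{\gamma}}(\boldsymbol{h})\big)^{1/2}$. $\|\cdot\|_{L_2}$ is the norm of $L_2([0,1]^d)$. **Parameters.** For $\tau>0$ and prime $N$, $$P_N(\tau,d,\boldsymbol{\gamma})=\prod_{j=1}^d\big(1+2\gamma_j^{1/(2\alpha)}(1+\tau\log N)\big),\qquad N_*=\frac{N-1}{\exp(\tau^{-1})P_N(\tau,d,\boldsymbol{\gamma})}.$$ For real $L\ge1$, $\mathcal{A}_d(L)=\{\boldsymbol{h}\in\mathbb{Z}^d: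 r_{2\alpha,\boldsymbol{\gamma}}(\boldsymbol{h})\le L^{2\alpha}\}$. **Median lattice-based algorithm.** Given $\tau$, a prime $N$ and an odd $R\in\mathbb{N}$, draw independently, for $r=1,\dots,R$, $\boldsymbol{z}_r$ uniformly from $\{1,\dots,N-1\}^d$ and $\boldsymbol{\Delta}_r$ uniformly from $[0,1)^d$. For $\boldsymbol{h}\in\mathcal{A}_d(N_* )$ set $$\widehat f_{N,\boldsymbol{z}_r,\boldsymbol{\Delta}_r}(\boldsymbol{h})=\frac1N\sum_{k=0}^{N-1}f\Big(\Big\{\frac{k\boldsymbol{z}_r}{N}+\boldsymbol{\Delta}_r\Big\}\Big)\exp\Big(-2\pi \mathrm{i}\,\boldsymbol{h}\cdot\Big(\frac{k\boldsymbol{z}_r}{N}+\boldsymbol{\Delta}_r\Big)\Big),$$ where $\{\cdot\}$ is the componentwise fractional part, and let $\widehat f_{\mathrm{med}}(\boldsymbol{h})$ be the median over $r\in\{1,\dots,R\}$ of these numbers, the median of complex numbers being the median of the real parts plus $\mathrm{i}$ times the median of the imaginary parts. The output is $(A^{\mathrm{rand}}(f))(\boldsymbol{x})=\sum_{\boldsymbol{h}\in\mathcal{A}_d(N_* )}\widehat f_{\mathrm{med}}(\boldsymbol{h})\exp(2\pi \mathrm{i}\,\boldsymbol{h}\cdot\boldsymbol{x})$. The expectation $\mathbb{E}$ is over the random choice of all $\boldsymbol{z}_r,\boldsymbol{\Delta}_r$. **Budget-based parameter choice.** Given $M_{\max}$ and $\delta$, let $N_{\max}$ be the largest prime $N$ with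 $$N\Big(2\log\Big(1+\frac{N-1}{4e}\Big)+2\log(\delta^{-1})+1\Big)\le M_{\max}.$$ Let $T$ be the set of all $\tau>0$ with $\exp(4e\tau^{-1})P_{N_{\max}}(\tau,d,\boldsymbol{\gamma})\le\exp(-4e)(N_{\max}-1)$. The budget $M_{\max}$ is called admissible (for $d$) if $N_{\max}$ exists and $T\neq\emptyset$; in that case $T$ is a compact interval $[\tau_1,\tau_2]$ (possibly a single point), and every sufficiently large $M_{\max}$ is admissible. Let $\tau_*$ be the (unique) minimizer of $\tau\mapsto\exp(\tau^{-1})P_{N_{\max}}(\tau,d,\boldsymbol{\gamma})$ over $T$, i.e. the choice maximizing $N_*$. With $N=N_{\max}$, let $R$ be an odd integer with $$2\log\Big(1+\frac{N-1}{4e}\Big)+2\log(\delta^{-1})-1\le R\le2\log\Big(1+\frac{N-1}{4e}\Big)+2\log(\delta^{-1})+1 .$$ *)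

(* Defs.v *)
From HB Require Import structures.
From mathcomp Require Import all_boot all_order all_algebra finmap.
From mathcomp Require Import all_classical all_reals all_analysis.
From mathcomp Require Export complex.

Set Implicit Arguments.
Unset Strict Implicit.
Unset Printing Implicit Defensive.

Import Order.TTheory GRing.Theory Num.Theory.
Import numFieldNormedType.Exports.

Local Open Scope classical_set_scope.
Local Open Scope ring_scope.
Local Open Scope complex_scope.

(** The library has the sigma-algebra on [n.-tuple T] but no measure on it:
    [iid P n] is the [n]-fold product of [P], obtained by transporting
    [P \x iid P n] along [(x, t) |-> x :: t]. *)
Section iid.
Context {dT : measure_display} {T : measurableType dT} {R : realType}.

Definition tuple_cons (n : nat) (p : T * n.-tuple T) : n.+1.-tuple T :=
  [the n.+1.-tuple T of p.1 :: p.2].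

Lemma measurable_tuple_cons (n : nat) :
  measurable_fun [set: T * n.-tuple T] (@tuple_cons n).
Proof. exact: measurable_cons. Qed.

HB.instance Definition _ (n : nat) :=
  isMeasurableFun.Build _ _ _ _ (@tuple_cons n) (@measurable_tuple_cons n).

Fixpoint iid (P : probability T R) (n : nat) : probability (n.-tuple T) R :=
  match n with
  | 0 => \d_ [tuple]
  | m.+1 => distribution (P \x iid P m)%E (@tuple_cons m)
  end.
End iid.

(** The uniform distribution on [0,1]^d.  It is Lebesgue measure on the unit
    cube, and the half-open cube has full measure, so the same measure serves
    for integrals over [0,1]^d and for uniform draws from [0,1)^d. *)
Definition cube_unif (R : realType) (d : nat) :
    probability (d.-tuple (measurableTypeR R)) R :=
  iid (uniform_prob (@ltr01 R)) d.

Section complex_analysis.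
Variable R : realType.

Definition cabs (z : R[i]) : R := ComplexField.Normc.normc z.

Definition cexp2pi (t : R) : R[i] := cos (2 * pi * t) +i* sin (2 * pi * t).

Definition cintegral (dT : measure_display) (T : measurableType dT)
    (mu : {measure set T -> \bar R}) (f : T -> R[i]) : R[i] :=
  Rintegral mu setT (fun x => complex.Re (f x)) +i*
  Rintegral mu setT (fun x => complex.Im (f x)).

(** [s] is the limit of the net of finite partial sums of [F]. *)
Definition has_csum (I : choiceType) (F : I -> R[i]) (s : R[i]) : Prop :=
  forall e : R, 0 < e -> exists J : {fset I}, forall K : {fset I},
    (J `<=` K)%fset -> cabs (s - \sum_(i <- K) F i) <= e.

Definition L2norm (d : nat) (g : d.-tuple R -> R[i]) : \bar R :=
  Lnorm (cube_unif R d) 2%:E (fun x => (cabs (g x))%:E).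

Definition median (s : seq R) : R := nth 0 (sort <=%R s) (size s)./2.

Definition cmedian (s : seq R[i]) : R[i] :=
  median [seq complex.Re z | z <- s] +i* median [seq complex.Im z | z <- s].

End complex_analysis.

Section Korobov.
Variables (R : realType) (d : nat).

Definition dotp (h : d.-tuple int) (x : d.-tuple R) : R :=
  \sum_(j < d) (tnth h j)%:~R * tnth x j.

Definition fourier_coef (f : d.-tuple R -> R[i]) (h : d.-tuple int) : R[i] :=
  cintegral (cube_unif R d) (fun x => f x * cexp2pi (- dotp h x)).

(** Weights are indexed from 0: [gamma j] stands for gamma_{j+1}. *)
Definition r_weight (alpha : R) (gamma : nat -> R) (h : d.-tuple int) : R :=
  \prod_(j < d)
    Num.max (`|(tnth h j)%:~R : R| `^ (2 * alpha) / gamma j) 1.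

Definition periodic (f : d.-tuple R -> R[i]) : Prop :=
  forall (i : 'I_d) (x : d.-tuple R),
    f [tuple tnth x j + (j == i)%:R | j < d] = f x.

Definition korobov_norm (alpha : R) (gamma : nat -> R)
    (f : d.-tuple R -> R[i]) : \bar R :=
  ((\esum_(h in [set: d.-tuple int])
      (cabs (fourier_coef f h) ^+ 2 * r_weight alpha gamma h)%:E)
     `^ 2^-1)%E.

(** One-periodic functions on [0,1]^d are represented by their periodic
    extension to R^d. *)
Definition korobov (alpha : R) (gamma : nat -> R) : set (d.-tuple R -> R[i]) :=
  [set f | [/\ periodic f,
    (\esum_(h in [set: d.-tuple int]) (cabs (fourier_coef f h))%:E < +oo)%E,
    forall x : d.-tuple R, (forall j, 0 <= tnth x j <= 1) ->
      has_csum (fun h => fourier_coef f h * cexp2pi (dotp h x)) (f x) &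
    (korobov_norm alpha gamma f < +oo)%E]].

Definition A_set (alpha : R) (gamma : nat -> R) (L : R) : set (d.-tuple int) :=
  [set h | r_weight alpha gamma h <= L `^ (2 * alpha)].

Definition P_fun (alpha : R) (gamma : nat -> R) (N : nat) (tau : R) : R :=
  \prod_(j < d)
    (1 + 2 * gamma j `^ (2 * alpha)^-1 * (1 + tau * ln N%:R)).

Definition N_star (alpha : R) (gamma : nat -> R) (N : nat) (tau : R) : R :=
  (N%:R - 1) / (expR tau^-1 * P_fun alpha gamma N tau).

End Korobov.
Arguments P_fun {R} d.
Arguments N_star {R} d.
Arguments korobov {R} d.
Arguments A_set {R} d.

Section median_algorithm.
Variables (R : realType) (d : nat).

Definition frac (x : R) : R := x - (Num.floor x)%:~R.

(** The components of [z] are elements of ['I_N], read as integers; the value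
    0 is excluded only in [draws] below. *)
Definition lattice_pt (N : nat) (z : d.-tuple 'I_N) (Delta : d.-tuple R)
    (k : nat) : d.-tuple R :=
  [tuple k%:R * (tnth z j)%:R / N%:R + tnth Delta j | j < d].

Definition fhat_lattice (f : d.-tuple R -> R[i]) (N : nat)
    (z : d.-tuple 'I_N) (Delta : d.-tuple R) (h : d.-tuple int) : R[i] :=
  N%:R^-1 * \sum_(k < N)
    f [tuple frac (tnth (lattice_pt z Delta k) j) | j < d]
    * cexp2pi (- dotp h (lattice_pt z Delta k)).

Definition fhat_med (f : d.-tuple R -> R[i]) (N nR : nat)
    (z : nR.-tuple (d.-tuple 'I_N)) (Delta : nR.-tuple (d.-tuple R))
    (h : d.-tuple int) : R[i] :=
  cmedian [seq fhat_lattice f (tnth z r) (tnth Delta r) h | r <- enum 'I_nR].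

Definition A_rand (alpha : R) (gamma : nat -> R) (tau : R) (N nR : nat)
    (z : nR.-tuple (d.-tuple 'I_N)) (Delta : nR.-tuple (d.-tuple R))
    (f : d.-tuple R -> R[i]) (x : d.-tuple R) : R[i] :=
  \sum_(h \in A_set d alpha gamma (N_star d alpha gamma N tau))
    fhat_med f z Delta h * cexp2pi (dotp h x).

Definition draws (N nR : nat) : {set nR.-tuple (d.-tuple 'I_N)} :=
  [set z : nR.-tuple (d.-tuple 'I_N) |
    [forall r, forall j, (0 < (tnth (tnth z r) j : 'I_N))%N]]%SET.

(** Expectation over independent draws: the z_r form a uniform element of the
    finite set [draws N nR], hence the average, and the Delta_r are
    independent of them with the product law of uniform distributions. *)
Definition expectation (N nR : nat)
    (X : nR.-tuple (d.-tuple 'I_N) -> nR.-tuple (d.-tuple R) -> \bar R) :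
    \bar R :=
  ((#|draws N nR|%:R^-1)%:E *
   \sum_(z in draws N nR) \int[iid (cube_unif R d) nR]_Delta X z Delta)%E.

Definition rms_error (alpha : R) (gamma : nat -> R) (tau : R) (N nR : nat)
    (f : d.-tuple R -> R[i]) : \bar R :=
  (@expectation N nR (fun z Delta =>
     L2norm (fun x => f x - A_rand alpha gamma tau z Delta f x)%R ^+ 2)
   `^ 2^-1)%E.

Definition worst_error (alpha : R) (gamma : nat -> R) (tau : R) (N nR : nat) :
    \bar R :=
  ereal_sup [set rms_error alpha gamma tau N nR f | f in
    [set f | korobov d alpha gamma f /\ (korobov_norm alpha gamma f <= 1)%E]].

End median_algorithm.
Arguments worst_error {R} d.

Section budget.
Variable R : realType.

Definition e4 : R := 4 * expR 1.

Definition log_term (delta : R) (N : nat) : R :=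
  2 * ln (1 + (N%:R - 1) / e4) + 2 * ln delta^-1.

Definition within_budget (delta Mmax : R) (N : nat) : Prop :=
  prime N /\ N%:R * (log_term delta N + 1) <= Mmax.

Definition is_Nmax (delta Mmax : R) (N : nat) : Prop :=
  within_budget delta Mmax N /\
  (forall N' : nat, within_budget delta Mmax N' -> (N' <= N)%N).

Definition T_set (alpha : R) (gamma : nat -> R) (d N : nat) : set R :=
  [set tau | 0 < tau /\
     expR (e4 * tau^-1) * P_fun d alpha gamma N tau
       <= expR (- e4) * (N%:R - 1)].

Definition admissible (alpha : R) (gamma : nat -> R) (delta : R) (d : nat)
    (Mmax : R) : Prop :=
  exists N : nat, is_Nmax delta Mmax N /\ T_set alpha gamma d N !=set0.

Definition is_tau_star (alpha : R) (gamma : nat -> R) (d N : nat) (tau : R) :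
    Prop :=
  T_set alpha gamma d N tau /\
  (forall tau' : R, T_set alpha gamma d N tau' ->
     expR tau^-1 * P_fun d alpha gamma N tau
       <= expR tau'^-1 * P_fun d alpha gamma N tau').

Definition is_repetition (delta : R) (N nR : nat) : Prop :=
  odd nR /\ log_term delta N - 1 <= nR%:R <= log_term delta N + 1.

Definition rate_bound (alpha : R) (gamma : nat -> R) (delta : R) (d : nat)
    (eps C : R) : Prop :=
  forall Mmax : R, admissible alpha gamma delta d Mmax ->
  forall (N nR : nat) (tau : R),
    is_Nmax delta Mmax N ->
    is_tau_star alpha gamma d N tau ->
    is_repetition delta N nR ->
    (worst_error d alpha gamma tau N nR
       <= (C * (nR * N)%:R `^ (- alpha + eps))%:E)%E.

End budget.

(* Main.v *)
Require Import Defs.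
From mathcomp Require Import all_boot all_order all_algebra finmap.
From mathcomp Require Import all_classical all_reals all_analysis.
From mathcomp Require Import measurable_realfun ring lra zify.
Set Implicit Arguments.
Unset Strict Implicit.
Unset Printing Implicit Defensive.
Import Order.TTheory GRing.Theory Num.Theory.
Import numFieldNormedType.Exports.
Local Open Scope classical_set_scope.
Local Open Scope ring_scope.

(** The error splits, by orthogonality, into the energy of [f] outside
    [A_d(N_star)] and the errors of the medians on [A_d(N_star)].  For one draw the
    mean square over [Delta] of the coefficient error at [h] is the energy of
    the frequencies [m <> h] aliased to [h], i.e. with [N | (m - h).z].  Call
    [z] bad for [h] if such an [m] lies in [A_d(L)], where
    [L = N_star / (4 exp(1 + 2 alpha))].  Since
    [|A_d(L)| <= L exp(1/tau) P_N(tau)], this has probability at most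
    [L / N_star], so a majority of bad draws has probability [O(N^(-1-2 alpha))].
    Otherwise the median error is bounded by the sum of the errors of the good
    draws, and averaging over [z] gives [O(R L^(-2 alpha))] after summation
    over [h].  Hence the mean square error is [O(R N_star^(-2 alpha))] with a
    constant depending on [alpha] only.

    Put [Q(tau) = exp(1/tau) P_N(tau)], so that [N_star = (N-1) / Q(tau_star)].  Any
    [tau' > 0] gives [Q(tau_star) <= exp(4e) exp(4e/tau') P_N(tau')]: if [tau']
    lies in [T] by minimality of [tau_star], and otherwise because
    [Q(tau_star) <= N - 1].  With [G >= sum_(j <= d) gamma_j^(1/(2 alpha))] and
    [tau' = eta / (2 G)] the right-hand side is at most
    [exp(4e + kappa G) N^eta], and the three claims differ only in the choice
    of [G]. *)

(** * Bounded measurable functions *)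

Section bounded_measurable.
Context {dT : measure_display} {T : measurableType dT} {R : realType}.

(** A class closed under sums and products, each member of which is integrable for every
    probability. Linearity and Fubini then apply without further side conditions. *)
Definition bmeas (g : T -> R) :=
  measurable_fun [set: T] g /\ exists M : R, forall x, `|g x| <= M.

Lemma bmeas_integrable (P : probability T R) (g : T -> R) :
  bmeas g -> P.-integrable [set: T] (EFin \o g).
Proof.
move=> [mg [M gM]]; apply: measurable_bounded_integrable => //.
  exact: le_lt_trans (probability_le1 P measurableT) (ltry _).
exists M; split; first by rewrite num_real.
by move=> y My x _; exact: le_trans (gM x) (ltW My).
Qed.

Lemma bmeas_cst (c : R) : bmeas (fun=> c).
Proof. by split; [exact: measurable_cst | exists `|c|]. Qed.

Lemma bmeasD (f g : T -> R) : bmeas f -> bmeas g -> bmeas (fun x => f x + g x).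
Proof.
move=> [mf [M fM]] [mg [M' gM]]; split; first exact: measurable_funD.
by exists (M + M') => x; apply: le_trans (ler_normD _ _) _; exact: lerD.
Qed.

Lemma bmeasM (f g : T -> R) : bmeas f -> bmeas g -> bmeas (fun x => f x * g x).
Proof.
move=> [mf [M fM]] [mg [M' gM]]; split; first exact: measurable_funM.
by exists (M * M') => x; rewrite normrM ler_pM.
Qed.

Lemma bmeas_sum (I : Type) (s : seq I) (f : I -> T -> R) :
  (forall i, bmeas (f i)) -> bmeas (fun x => \sum_(i <- s) f i x).
Proof.
move=> bf; elim: s => [|i s IH].
  by under eq_fun do rewrite big_nil; exact: bmeas_cst.
by under eq_fun do rewrite big_cons; exact: bmeasD.
Qed.

Lemma bmeas_cos (u : T -> R) : measurable_fun [set: T] u -> bmeas (fun x => cos (u x)).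
Proof.
move=> mu; split; last by exists 1 => x; exact: cos_max.
apply: measurableT_comp => //; apply: continuous_measurable_fun; exact: continuous_cos.
Qed.

Lemma bmeas_sin (u : T -> R) : measurable_fun [set: T] u -> bmeas (fun x => sin (u x)).
Proof.
move=> mu; split; last by exists 1 => x; exact: sin_max.
apply: measurableT_comp => //; apply: continuous_measurable_fun; exact: continuous_sin.
Qed.

Lemma Rintegral_cst_probability (P : probability T R) (c : R) : \int[P]_x c = c.
Proof.
rewrite Rintegral_cst// -[RHS]mulr1; congr (_ * _).
by have := @probability_setT _ _ _ P => /= ->.
Qed.

Lemma integral_EFin_bmeas (P : probability T R) (g : T -> R) :
  bmeas g -> (\int[P]_x (g x)%:E)%E = (\int[P]_x g x)%:E.
Proof.
by move=> bg; rewrite /Rintegral fineK// integrable_fin_num//; exact: bmeas_integrable.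
Qed.

Lemma Rintegral_sum_bmeas (P : probability T R) (I : Type) (s : seq I) (f : I -> T -> R) :
  (forall i, bmeas (f i)) ->
  \int[P]_x (\sum_(i <- s) f i x) = \sum_(i <- s) \int[P]_x f i x.
Proof.
move=> bf; elim: s => [|i s IH].
  under eq_Rintegral do rewrite big_nil.
  by rewrite Rintegral_cst_probability big_nil.
under eq_Rintegral do rewrite big_cons.
rewrite RintegralD// ?IH ?big_cons//; apply: bmeas_integrable => //.
exact: bmeas_sum.
Qed.

(* The integral of a nonnegative function is a supremum over simple functions below it, so monotonicity
   holds without measurability; this spares the measurability of medians and of [f]. *)
Lemma le_integral_nonmeasurable (mu : {measure set T -> \bar R}) (f g : T -> \bar R) :
  (forall x, 0 <= f x)%E -> (forall x, f x <= g x)%E ->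
  (\int[mu]_x f x <= \int[mu]_x g x)%E.
Proof.
move=> f0 fg; rewrite !ge0_integralTE//; last by move=> x; exact: le_trans (fg x).
apply: ge_ereal_sup => _ [h /= hf <-]; apply: ereal_sup_ubound.
by exists h => //= x; exact: le_trans (hf x) (fg x).
Qed.

End bounded_measurable.

(** * Integrals over product measures *)

Section product.
Context {d1 d2 : measure_display} {T1 : measurableType d1} {T2 : measurableType d2}.
Context {R : realType} (P1 : probability T1 R) (P2 : probability T2 R).

Lemma bmeas_prod (u : T1 -> R) (v : T2 -> R) : bmeas u -> bmeas v ->
  bmeas (fun p : T1 * T2 => u p.1 * v p.2).
Proof.
move=> bu bv; apply: bmeasM.
  by case: bu => mu [M uM]; split; [exact: measurableT_comp|exists M].
by case: bv => mv [M vM]; split; [exact: measurableT_comp|exists M].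
Qed.

Lemma Rintegral_prod (u : T1 -> R) (v : T2 -> R) : bmeas u -> bmeas v ->
  \int[(P1 \x P2)%E]_p (u p.1 * v p.2) = (\int[P1]_x u x) * (\int[P2]_y v y).
Proof.
move=> bu bv.
have bm := bmeas_prod bu bv.
have ip := bmeas_integrable (P1 \x P2)%E bm.
have iu := bmeas_integrable P1 bu; have iv := bmeas_integrable P2 bv.
apply: EFin_inj; rewrite -integral_EFin_bmeas// -(integral12_prod_meas1 ip).
rewrite EFinM -(integral_EFin_bmeas P1 bu) -integralZr//.
apply: eq_integral => x _ /=.
rewrite -integral_EFin_bmeas// -integralZl//.
Qed.

(** Shaped after the addition formula for the sine; the version with a difference serves the cosine.
    Both drive the induction on the dimension. *)
Lemma Rintegral_prodD (u u' : T1 -> R) (v v' : T2 -> R) :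
  bmeas u -> bmeas v -> bmeas u' -> bmeas v' ->
  \int[(P1 \x P2)%E]_p (u p.1 * v p.2 + u' p.1 * v' p.2) =
  (\int[P1]_x u x) * (\int[P2]_y v y) + (\int[P1]_x u' x) * (\int[P2]_y v' y).
Proof.
move=> bu bv bu' bv'; rewrite -!Rintegral_prod// RintegralD//.
  by apply: bmeas_integrable; exact: bmeas_prod bu bv.
by apply: bmeas_integrable; exact: bmeas_prod bu' bv'.
Qed.

Lemma Rintegral_prodB (u u' : T1 -> R) (v v' : T2 -> R) :
  bmeas u -> bmeas v -> bmeas u' -> bmeas v' ->
  \int[(P1 \x P2)%E]_p (u p.1 * v p.2 - u' p.1 * v' p.2) =
  (\int[P1]_x u x) * (\int[P2]_y v y) - (\int[P1]_x u' x) * (\int[P2]_y v' y).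
Proof.
move=> bu bv bu' bv'; rewrite -!Rintegral_prod// RintegralB//.
  by apply: bmeas_integrable; exact: bmeas_prod bu bv.
by apply: bmeas_integrable; exact: bmeas_prod bu' bv'.
Qed.

End product.

(** * Orthogonality of the exponentials *)

Section orthogonality.
Variable R : realType.
Implicit Types (k : int) (x t : R).

Lemma cos2piz k : cos (2 * pi * k%:~R) = 1 :> R.
Proof.
have H n : cos (2 * pi * n%:R) = 1 :> R.
  elim: n => [|n IH]; first by rewrite mulr0 cos0.
  rewrite -[n.+1%:R]natr1 mulrDr mulr1.
  by have -> : 2 * pi = pi *+ 2 :> R; [rewrite mulr_natl | rewrite cosD2pi -[pi *+ 2]mulr_natl IH].
case: k => n; first exact: H.
by rewrite NegzE mulrNz mulrN cosN; exact: H.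
Qed.

Lemma sin2piz k : sin (2 * pi * k%:~R) = 0 :> R.
Proof.
have H n : sin (2 * pi * n%:R) = 0 :> R.
  elim: n => [|n IH]; first by rewrite mulr0 sin0.
  rewrite -[n.+1%:R]natr1 mulrDr mulr1.
  by have -> : 2 * pi = pi *+ 2 :> R; [rewrite mulr_natl | rewrite sinD2pi -[pi *+ 2]mulr_natl IH].
case: k => n; first exact: H.
by rewrite NegzE mulrNz mulrN sinN; apply/eqP; rewrite oppr_eq0; apply/eqP/H.
Qed.

Lemma integral_uniform01_FTC (f F : R -> R) (M : R) :
  continuous f -> (forall x, `|f x| <= M) -> (forall x, is_derive x 1 F (f x)) ->
  \int[uniform_prob (@ltr01 R)]_x f x = F 1 - F 0.
Proof.
move=> cf fM dF.
have bf : bmeas f by split; [exact: continuous_measurable_fun|exists M].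
(* [integral_uniform] takes a nonnegative integrand, so [f] is raised by its bound [M], which adds
   [M] to both sides. *)
have bM : bmeas (fun x => f x + M) by apply: bmeasD => //; exact: bmeas_cst.
suff : \int[uniform_prob (@ltr01 R)]_x (f x + M) = F 1 - F 0 + M.
  rewrite RintegralD//; [|exact: bmeas_integrable|by apply: bmeas_integrable; exact: bmeas_cst].
  rewrite Rintegral_cst_probability => /(congr1 (fun y => y - M)).
  by rewrite !addrK.
rewrite /Rintegral integral_uniform; last 2 first.
- by apply/measurable_EFinP; case: bM.
- move=> x; rewrite lee_fin -lerBlDr sub0r lerNl.
  by apply: le_trans (fM x); rewrite -normrN ler_norm.
have dG (x : R) : is_derive x 1 (fun y => F y + M * y) (f x + M).
  have := dF x => ?.
  have -> : (fun y => F y + M * y) = F + M *: (id : R -> R) by apply/funext => y.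
  have -> : f x + M = f x + M *: (1 : R) by rewrite /GRing.scale /= mulr1.
  exact: is_deriveD.
have cG : continuous (fun y => F y + M * y).
  by move=> x; apply: differentiable_continuous; apply/derivable1_diffP; have [] := dG x.
rewrite (@continuous_FTC2 _ (fun x => f x + M) (fun x => F x + M * x)) ?ltr01//=.
- by rewrite subr0 invr1 mulr1 mulr0 addr0 mul1r; ring.
- by apply: continuous_subspaceT => x; apply: cvgD; [exact: cf|exact: cvg_cst].
- split.
  + by move=> x _; have [] := dG x.
  + exact: cvg_at_right_filter (cG _).
  + exact: cvg_at_left_filter (cG _).
- by move=> x _; rewrite derive1E; have [_ ->] := dG x.
Qed.

Lemma integral_uniform_cos k :
  \int[uniform_prob (@ltr01 R)]_x cos (2 * pi * (k%:~R * x)) = (k == 0)%:R.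
Proof.
have [->|k0] := eqVneq k 0.
  under eq_Rintegral do rewrite mul0r mulr0 cos0.
  by rewrite Rintegral_cst_probability.
pose c : R := 2 * pi * k%:~R.
have c0 : c != 0 by rewrite !mulf_neq0 ?intr_eq0// gt_eqF ?pi_gt0.
have E x : 2 * pi * (k%:~R * x) = c * x by rewrite /c; ring.
under eq_Rintegral do rewrite E.
transitivity (c^-1 * sin (c * 1) - c^-1 * sin (c * 0)); last first.
  by rewrite mulr1 mulr0 sin0 /c sin2piz !mulr0 subrr.
apply: (@integral_uniform01_FTC _ (fun x => c^-1 * sin (c * x)) 1).
- move=> x; apply: (@continuous_comp _ _ _ ( *%R c) cos); last exact: continuous_cos.
  exact: mulrl_continuous.
- by move=> x; exact: cos_max.
- move=> x.
  have D1 : is_derive x 1 ( *%R c : R -> R) c.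
    have : is_derive x 1 (c *: (id : R -> R)) (c *: (1 : R)) by exact: is_deriveZ.
    by rewrite [c *: (1 : R)]mulr1.
  have D2 := is_derive1_comp (is_derive_sin (c * x)) D1.
  have : is_derive x 1 (c^-1 *: (sin \o *%R c)) (c^-1 *: (cos (c * x) * c)) by exact: is_deriveZ.
  by rewrite {2}/GRing.scale /= [_ * c]mulrC mulKf.
Qed.

Lemma integral_uniform_sin k :
  \int[uniform_prob (@ltr01 R)]_x sin (2 * pi * (k%:~R * x)) = 0.
Proof.
have [->|k0] := eqVneq k 0.
  under eq_Rintegral do rewrite mul0r mulr0 sin0.
  by rewrite Rintegral_cst_probability.
pose c : R := 2 * pi * k%:~R.
have c0 : c != 0 by rewrite !mulf_neq0 ?intr_eq0// gt_eqF ?pi_gt0.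
have E x : 2 * pi * (k%:~R * x) = c * x by rewrite /c; ring.
under eq_Rintegral do rewrite E.
transitivity (- c^-1 * cos (c * 1) - (- c^-1 * cos (c * 0))); last first.
  by rewrite mulr1 mulr0 cos0 /c cos2piz subrr.
apply: (@integral_uniform01_FTC _ (fun x => - c^-1 * cos (c * x)) 1).
- move=> x; apply: (@continuous_comp _ _ _ ( *%R c) sin); last exact: continuous_sin.
  exact: mulrl_continuous.
- by move=> x; exact: sin_max.
- move=> x.
  have D1 : is_derive x 1 ( *%R c : R -> R) c.
    have : is_derive x 1 (c *: (id : R -> R)) (c *: (1 : R)) by exact: is_deriveZ.
    by rewrite [c *: (1 : R)]mulr1.
  have D2 := is_derive1_comp (is_derive_cos (c * x)) D1.
  have : is_derive x 1 (- c^-1 *: (cos \o *%R c)) (- c^-1 *: (- sin (c * x) * c)) by exact: is_deriveZ.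
  by rewrite {2}/GRing.scale /= !mulNr mulrN opprK [_ * c]mulrC mulKf.
Qed.

End orthogonality.

(** * Fourier integrals over the cube *)

Section fourier_iid.
Variable R : realType.

Lemma measurable_dotp d (h : d.-tuple int) :
  measurable_fun [set: d.-tuple (measurableTypeR R)] (fun x => dotp h x).
Proof.
rewrite /dotp; apply: measurable_sum => j.
by apply: measurable_funM => //; exact: measurable_tnth.
Qed.

Lemma bmeas_cos_dotp d (h : d.-tuple int) :
  bmeas (fun x : d.-tuple (measurableTypeR R) => cos (2 * pi * dotp h x)).
Proof. by apply: bmeas_cos; apply: measurable_funM => //; exact: measurable_dotp. Qed.

Lemma bmeas_sin_dotp d (h : d.-tuple int) :
  bmeas (fun x : d.-tuple (measurableTypeR R) => sin (2 * pi * dotp h x)).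
Proof. by apply: bmeas_sin; apply: measurable_funM => //; exact: measurable_dotp. Qed.

Lemma dotp_cons d (k : int) (h : d.-tuple int) (p : R * d.-tuple R) :
  dotp [tuple of k :: h] [the d.+1.-tuple R of p.1 :: p.2] = k%:~R * p.1 + dotp h p.2.
Proof.
rewrite /dotp big_ord_recl !tnth0; congr (_ + _).
by apply: eq_bigr => j _; rewrite !tnthS.
Qed.

Lemma Rintegral_iid_cons {dT} {T : measurableType dT} (P : probability T R) d
    (g : d.+1.-tuple T -> R) : bmeas g ->
  \int[iid P d.+1]_x g x = \int[(P \x iid P d)%E]_p g (tuple_cons p).
Proof.
move=> bg; rewrite /Rintegral /= integral_distribution//.
  by apply/measurable_EFinP; case: bg.
apply: bmeas_integrable; case: bg => mg [M gM]; split; last by exists M => x /=.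
exact: measurableT_comp.
Qed.

(** Induction on [d], for cosine and sine together because the addition formulas mix them. Products
    containing a sine integral vanish, which leaves a product of Kronecker deltas for the cosine. *)
Lemma integral_cube_cos_sin d (h : d.-tuple int) :
  \int[cube_unif R d]_x cos (2 * pi * dotp h x) = (h == nseq_tuple d 0)%:R /\
  \int[cube_unif R d]_x sin (2 * pi * dotp h x) = 0.
Proof.
elim: d h => [|d IH] h.
  have -> : h == nseq_tuple 0 0 by apply/eqP; rewrite [LHS]tuple0 [RHS]tuple0.
  have E (x : 0.-tuple R) : dotp h x = 0 by rewrite /dotp big_ord0.
  split; under eq_Rintegral do rewrite E mulr0 ?cos0 ?sin0; exact: Rintegral_cst_probability.
case/tupleP: h => k h; have [IHc IHs] := IH h.
pose U := uniform_prob (@ltr01 R).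
have bc : bmeas (fun x : measurableTypeR R => cos (2 * pi * (k%:~R * x))).
  by apply: bmeas_cos; apply: measurable_funM => //; apply: measurable_funM.
have bs : bmeas (fun x : measurableTypeR R => sin (2 * pi * (k%:~R * x))).
  by apply: bmeas_sin; apply: measurable_funM => //; apply: measurable_funM.
have bch := bmeas_cos_dotp h; have bsh := bmeas_sin_dotp h.
have EH : ([tuple of k :: h] == nseq_tuple d.+1 0) = (k == 0) && (h == nseq_tuple d 0).
  by rewrite -!val_eqE /= eqseq_cons.
split.
- rewrite [LHS]Rintegral_iid_cons; last exact: bmeas_cos_dotp.
  under eq_Rintegral do rewrite dotp_cons mulrDr cosD.
  rewrite (Rintegral_prodB _ _ bc bch bs bsh) IHs mulr0 subr0 IHc.
  by rewrite integral_uniform_cos EH -natrM mulnb.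
- rewrite [LHS]Rintegral_iid_cons; last exact: bmeas_sin_dotp.
  under eq_Rintegral do rewrite dotp_cons mulrDr sinD.
  rewrite (Rintegral_prodD _ _ bs bch bc bsh) IHs mulr0 addr0.
  by rewrite integral_uniform_sin mul0r.
Qed.

End fourier_iid.

(** * Trigonometric polynomials *)

Section complex_exponentials.
Variable R : realType.
Implicit Types (z w : R[i]) (t : R).

Definition sqn z : R := complex.Re z ^+ 2 + complex.Im z ^+ 2.

Lemma cabs_sqr z : cabs z ^+ 2 = sqn z.
Proof. by case: z => a b; rewrite /cabs /= sqr_sqrtr// addr_ge0// sqr_ge0. Qed.

Lemma sqn_ge0 z : 0 <= sqn z.
Proof. by rewrite -cabs_sqr sqr_ge0. Qed.

Lemma cabs_ge0 z : 0 <= cabs z.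
Proof. by case: z => a b; exact: sqrtr_ge0. Qed.

Lemma cabsM z w : cabs (z * w) = cabs z * cabs w.
Proof. exact: ComplexField.Normc.normcM. Qed.

Lemma cabsD z w : cabs (z + w) <= cabs z + cabs w.
Proof. exact: le_normcD. Qed.

Lemma cabsN z : cabs (- z) = cabs z.
Proof. exact: normcN. Qed.

Lemma cabs0 : cabs (0 : R[i]) = 0.
Proof. by rewrite /cabs ComplexField.Normc.normc0. Qed.

Lemma cabs_sum (I : Type) (s : seq I) (P : pred I) (F : I -> R[i]) :
  cabs (\sum_(i <- s | P i) F i) <= \sum_(i <- s | P i) cabs (F i).
Proof.
elim/big_ind2: _ => //; first by rewrite cabs0.
by move=> z x w y zx wy; apply: le_trans (cabsD _ _) _; exact: lerD.
Qed.

Lemma sqnM z w : sqn (z * w) = sqn z * sqn w.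
Proof. by rewrite -!cabs_sqr cabsM exprMn. Qed.

Lemma sqnN z : sqn (- z) = sqn z.
Proof. by rewrite -!cabs_sqr cabsN. Qed.

Lemma sqn0 : sqn 0 = 0.
Proof. by rewrite -cabs_sqr cabs0 expr0n. Qed.

Lemma sqnD_le z w : sqn (z + w) <= 2 * sqn z + 2 * sqn w.
Proof.
case: z w => [a b] [c d]; rewrite /sqn /= -subr_ge0.
suff -> : 2 * (a ^+ 2 + b ^+ 2) + 2 * (c ^+ 2 + d ^+ 2) - ((a + c) ^+ 2 + (b + d) ^+ 2)
  = (a - c) ^+ 2 + (b - d) ^+ 2 by rewrite addr_ge0// sqr_ge0.
by ring.
Qed.

Lemma sqn_le_cabs z (e : R) : 0 <= e -> cabs z <= e -> sqn z <= e ^+ 2.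
Proof. by move=> e0 ze; rewrite -cabs_sqr ler_pXn2r ?nnegrE ?cabs_ge0. Qed.

Lemma cexp2piD s t : cexp2pi (s + t) = cexp2pi s * cexp2pi t.
Proof.
rewrite /cexp2pi mulrDr cosD sinD; apply/eqP.
by rewrite eq_complex /= eqxx /=; apply/eqP; ring.
Qed.

Lemma cexp2pi0 : cexp2pi (0 : R) = 1.
Proof. by rewrite /cexp2pi mulr0 cos0 sin0. Qed.

Lemma cexp2pi_int (k : int) : cexp2pi (k%:~R : R) = 1.
Proof. by rewrite /cexp2pi cos2piz sin2piz. Qed.

Lemma sqn_cexp2pi t : sqn (cexp2pi t) = 1.
Proof. by rewrite /sqn /= cos2Dsin2. Qed.

Lemma cabs_cexp2pi t : cabs (cexp2pi t) = 1.
Proof. by rewrite /cabs /= cos2Dsin2 sqrtr1. Qed.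

Lemma cexp2piN t : cexp2pi (- t) = conjc (cexp2pi t).
Proof. by rewrite /cexp2pi mulrN cosN sinN. Qed.

Lemma cexp2piX n t : cexp2pi (n%:R * t) = cexp2pi t ^+ n.
Proof.
elim: n => [|n IH]; first by rewrite mul0r cexp2pi0 expr0.
by rewrite exprS -IH -cexp2piD -nat1r mulrDl mul1r.
Qed.

Lemma Re_sum (I : Type) (s : seq I) (F : I -> R[i]) :
  complex.Re (\sum_(i <- s) F i) = \sum_(i <- s) complex.Re (F i).
Proof. by elim/big_rec2: _ => // i x z _ <-; case: (F i) z => [a b] [c d]. Qed.

(** Subtracting an integer leaves [b / N] with [0 < b < N]. With [u = pi b / N] in [(0, pi)] the
    real part is [1 - 2 sin(u)^2 < 1]. *)
Lemma cexp2pi_frac_neq1 (N : nat) (a : int) : (0 < N)%N -> ~~ (N%:Z %| a)%Z ->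
  cexp2pi (a%:~R / N%:R : R) != 1.
Proof.
move=> N0 Na; have N0z : N%:Z != 0 by rewrite gt_eqF// ltz_nat.
have NR : (N%:R : R) != 0 by rewrite pnatr_eq0 -lt0n.
rewrite [a in cexp2pi (a%:~R / _)](divz_eq a N%:Z) intrD intrM mulrDl.
rewrite mulfK// cexp2piD cexp2pi_int mul1r.
set b := (a %% N%:Z)%Z.
have b0 : 0 < b by rewrite lt0r modz_ge0// andbT; apply: contra Na => /eqP/dvdz_mod0P.
have bN : b < N%:Z by rewrite ltz_pmod// ltz_nat.
pose u : R := pi * (b%:~R / N%:R).
have su : 0 < sin u.
  apply: sin_gt0_pi; rewrite mulr_gt0 ?pi_gt0//=.
    by rewrite -[ltRHS]mulr1 ltr_pM2l ?pi_gt0// ltr_pdivrMr ?ltr0n// mul1r -[N%:R]/(N%:Z%:~R) ltr_int.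
  by rewrite divr_gt0 ?ltr0n// ltr0z.
rewrite eq_complex /= negb_and; apply/orP; left.
have -> : 2 * pi * (b%:~R / N%:R) = u *+ 2 :> R by rewrite -mulr_natl /u; ring.
rewrite cos_mulr2n cos2sin2 -mulr_natl lt_eqF//.
have : 0 < sin u ^+ 2 by rewrite exprn_gt0.
by move=> ?; lra.
Qed.

(** A geometric sum of ratio [w]: either [w = 1], or [w - 1] is nonzero and its product with the sum
    is [w^N - 1 = 0]. This character sum is the source of aliasing. *)
Lemma sum_cexp2pi_frac (N : nat) (a : int) : (0 < N)%N ->
  \sum_(k < N) cexp2pi (k%:R * (a%:~R / N%:R : R)) = (N * (N%:Z %| a)%Z)%:R.
Proof.
move=> N0; have NR : (N%:R : R) != 0 by rewrite pnatr_eq0 -lt0n.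
under eq_bigr do rewrite cexp2piX.
have [/dvdzP[q ->]|Na] := boolP (N%:Z %| a)%Z.
  rewrite intrM mulfK// cexp2pi_int.
  by under eq_bigr do rewrite expr1n; rewrite sumr_const card_ord muln1.
have w1 := cexp2pi_frac_neq1 N0 Na.
set w := cexp2pi _ in w1 *.
have : (w - 1) * \sum_(k < N) w ^+ k = 0.
  rewrite -subrX1 /w -cexp2piX mulrCA mulfV// mulr1 cexp2pi_int subrr//.
by move=> /eqP; rewrite mulf_eq0 subr_eq0 (negbTE w1) /= muln0 => /eqP.
Qed.

(** The square is the real part of the double sum of [c_i conj(c_j) e(p_i - p_j)], written with real
    cosines and sines so that real integration applies. *)
Lemma sqn_trig_sum (I : Type) (s : seq I) (c : I -> R[i]) (p : I -> R) :
  sqn (\sum_(i <- s) c i * cexp2pi (p i)) =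
  \sum_(i <- s) \sum_(j <- s)
    (complex.Re (c i * conjc (c j)) * cos (2 * pi * (p i - p j))
     + - complex.Im (c i * conjc (c j)) * sin (2 * pi * (p i - p j))).
Proof.
have conjM z w : conjc (z * w) = conjc z * conjc w by exact: rmorphM.
have conj_sum (F : I -> R[i]) : conjc (\sum_(i <- s) F i) = \sum_(i <- s) conjc (F i).
  exact: raddf_sum.
have -> z : sqn z = complex.Re (z * conjc z).
  by case: z => a b; rewrite /sqn /=; ring.
rewrite conj_sum big_distrlr/= Re_sum; apply: eq_bigr => i _.
rewrite Re_sum; apply: eq_bigr => j _.
have -> : c i * cexp2pi (p i) * conjc (c j * cexp2pi (p j))
    = c i * conjc (c j) * cexp2pi (p i - p j).
  by rewrite conjM -cexp2piN mulrACA -cexp2piD.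
by case: (c i * _) => a b; rewrite /cexp2pi /= mulNr.
Qed.

End complex_exponentials.

(** * Marginals of product measures and Parseval's identity *)

Section parseval.
Variable R : realType.

(** The other coordinates integrate to 1. The median error is bounded by a sum over the draws, so
    that marginals suffice for its mean. *)
Lemma Rintegral_iid_tnth {dT} {T : measurableType dT} (P : probability T R) n (r : 'I_n)
    (g : T -> R) : bmeas g ->
  \int[iid P n]_x g (tnth x r) = \int[P]_x g x.
Proof.
move=> bg.
have bgr m (i : 'I_m) : bmeas (fun x : m.-tuple T => g (tnth x i)).
  case: bg => mg [M gM]; split; last by exists M => x.
  by apply: (measurableT_comp mg); exact: measurable_tnth.
elim: n r => [|n IH] r; first by case: r.
rewrite Rintegral_iid_cons//.
have b1 d (S : measurableType d) : bmeas (fun _ : S => 1 : R) by exact: bmeas_cst.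
case: (unliftP ord0 r) => [j|] ->.
  under eq_Rintegral do rewrite tnthS -[g _]mul1r.
  rewrite (Rintegral_prod P (iid P n) (b1 _ _) (bgr n j)) Rintegral_cst_probability mul1r.
  exact: IH.
under eq_Rintegral do rewrite tnth0 -[g _]mulr1.
rewrite (Rintegral_prod P (iid P n) bg (b1 _ _)).
by rewrite Rintegral_cst_probability mulr1.
Qed.

Definition trigpoly d (s : seq (d.-tuple int)) (c : d.-tuple int -> R[i])
    (x : d.-tuple R) : R[i] := \sum_(m <- s) c m * cexp2pi (dotp m x).

Lemma dotpB d (h m : d.-tuple int) (x : d.-tuple R) :
  dotp h x - dotp m x = dotp [tuple tnth h j - tnth m j | j < d] x.
Proof.
rewrite /dotp -sumrB; apply: eq_bigr => j _.
by rewrite tnth_mktuple intrD mulrDl rmorphN mulNr.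
Qed.

Lemma subr_tuple_eq0 d (h m : d.-tuple int) :
  ([tuple tnth h j - tnth m j | j < d] == nseq_tuple d 0) = (h == m).
Proof.
apply/eqP/eqP => [E|->]; apply: eq_from_tnth => j.
  have := congr1 (fun t => tnth t j) E.
  by rewrite tnth_mktuple tnth_nseq => /eqP; rewrite subr_eq0 => /eqP.
by rewrite tnth_mktuple tnth_nseq subrr.
Qed.

Lemma bmeas_trigpoly d (s : seq (d.-tuple int)) (c : d.-tuple int -> R[i]) :
  bmeas (fun x : d.-tuple (measurableTypeR R) => sqn (trigpoly s c x)).
Proof.
under eq_fun do rewrite /trigpoly sqn_trig_sum.
apply: bmeas_sum => i; apply: bmeas_sum => j; apply: bmeasD; apply: bmeasM; try exact: bmeas_cst.
  by under eq_fun do rewrite dotpB; exact: bmeas_cos_dotp.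
by under eq_fun do rewrite dotpB; exact: bmeas_sin_dotp.
Qed.

(** After expansion of the square only the diagonal terms survive integration, [s] being free of
    repetitions. *)
Lemma parseval d (s : seq (d.-tuple int)) (c : d.-tuple int -> R[i]) : uniq s ->
  \int[cube_unif R d]_x sqn (trigpoly s c x) = \sum_(m <- s) sqn (c m).
Proof.
move=> us; under eq_Rintegral do rewrite /trigpoly sqn_trig_sum.
have bc i j : bmeas (fun x : d.-tuple (measurableTypeR R) => cos (2 * pi * (dotp i x - dotp j x))).
  by under eq_fun do rewrite dotpB; exact: bmeas_cos_dotp.
have bs i j : bmeas (fun x : d.-tuple (measurableTypeR R) => sin (2 * pi * (dotp i x - dotp j x))).
  by under eq_fun do rewrite dotpB; exact: bmeas_sin_dotp.
have bA (a : R) i j := bmeasM (bmeas_cst a) (bc i j).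
have bB (a : R) i j := bmeasM (bmeas_cst a) (bs i j).
rewrite Rintegral_sum_bmeas; last by move=> i; apply: bmeas_sum => j; exact: bmeasD.
apply: eq_big_seq => i si.
rewrite Rintegral_sum_bmeas; last by move=> j; exact: bmeasD.
have E j : \int[cube_unif R d]_x (complex.Re (c i * conjc (c j)) * cos (2 * pi * (dotp i x - dotp j x)) +
      - complex.Im (c i * conjc (c j)) * sin (2 * pi * (dotp i x - dotp j x)))
    = (i == j)%:R * complex.Re (c i * conjc (c j)).
  rewrite RintegralD//; [|exact: bmeas_integrable|exact: bmeas_integrable].
  rewrite !RintegralZl//; [|exact: bmeas_integrable|exact: bmeas_integrable].
  under eq_Rintegral do rewrite dotpB.
  under [X in _ + _ * X]eq_Rintegral do rewrite dotpB.
  have [-> ->] := integral_cube_cos_sin R [tuple tnth i k - tnth j k | k < d].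
  by rewrite subr_tuple_eq0 mulr0 addr0 mulrC.
under eq_bigr do rewrite E.
rewrite (bigD1_seq i)//= eqxx mul1r big1 ?addr0; last first.
  by move=> j /negbTE; rewrite eq_sym => ->; rewrite mul0r.
by case: (c i) => a b; rewrite /sqn /=; ring.
Qed.

End parseval.

(** * Medians *)

Section median.
Variable R : realType.

(** With [k = (size s)./2], the first [k + 1] sorted entries are at most the median and the last
    [k + 1] at least. The half on the side of the median away from [c] is at least as far from
    [c]. *)
Lemma count_median (s : seq R) (c : R) : odd (size s) ->
  ((size s)./2 < count (fun x => `|median s - c| <= `|x - c|)%R s)%N.
Proof.
move=> os; set v := median s; set a := (fun x => _).
have pst : perm_eq (sort <=%R s) s by rewrite perm_sort.
rewrite -(permP pst a); set t := sort _ s; set k := (size s)./2.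
have st : size t = size s by rewrite size_sort.
have sn : size s = (k.*2).+1 by rewrite -(odd_double_half (size s)) os.
have sorted_t : sorted <=%R t by apply: sort_sorted; exact: le_total.
have mono i j : (i <= j)%N -> (j < size t)%N -> nth 0 t i <= nth 0 t j.
  move=> ij js; apply: (sorted_leq_nth (@le_trans _ _) (@le_refl _ _)) => //.
  by rewrite inE (leq_ltn_trans ij).
have vE : v = nth 0 t k by [].
have [vc|cv] := ltP v c.
  rewrite -(cat_take_drop k.+1 t) count_cat; apply: leq_trans (leq_addr _ _).
  suff -> : count a (take k.+1 t) = size (take k.+1 t).
    by rewrite size_takel ?st ?sn; lia.
  apply/eqP; rewrite -all_count; apply/(all_nthP 0) => i.
  rewrite size_takel ?st ?sn; last by lia.
  rewrite ltnS => ik.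
  rewrite nth_take ?ltnS// /a; have := mono i k ik; rewrite st sn -vE => /(_ ltac:(lia)) iv.
  by rewrite !ltr0_norm ?subr_lt0//; [lra | exact: le_lt_trans vc].
rewrite -(cat_take_drop k t) count_cat; apply: leq_trans (leq_addl _ _).
suff -> : count a (drop k t) = size (drop k t) by rewrite size_drop st sn; lia.
apply/eqP; rewrite -all_count; apply/(all_nthP 0) => i.
rewrite size_drop st sn => ik.
rewrite nth_drop /a; have := mono k (k + i)%N; rewrite st sn -vE => /(_ ltac:(lia) ltac:(lia)) iv.
by rewrite !ger0_norm ?subr_ge0//; [lra | exact: le_trans iv].
Qed.

(** More than half of the entries are at least as far from [c] as the median, and at most half lie
    outside [U]; hence one of them has its index in [U]. *)
Lemma median_sqr_le n (x : 'I_n -> R) (c : R) (U : {set 'I_n}) : odd n ->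
  (#|~: U| <= n./2)%N ->
  (median [seq x r | r <- enum 'I_n] - c) ^+ 2 <= \sum_(r in U) (x r - c) ^+ 2.
Proof.
move=> on Un; set v := median _.
have := @count_median [seq x r | r <- enum 'I_n] c.
rewrite size_map size_enum_ord => /(_ on); rewrite count_map -/v => H.
have [r /andP[rU rv]] : exists r, (r \in U) && (`|v - c| <= `|x r - c|).
  apply/existsP; apply: contraLR H; rewrite negb_exists => /forallP H.
  rewrite -leqNgt -size_filter; apply: leq_trans Un.
  rewrite cardE; apply: uniq_leq_size; first by rewrite filter_uniq// enum_uniq.
  move=> r; rewrite mem_filter /= => /andP[rv _]; rewrite mem_enum inE.
  by have := H r; rewrite rv andbT.
rewrite (bigD1 r)//= -[leLHS]addr0 lerD//; last by apply: sumr_ge0 => *; exact: sqr_ge0.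
by rewrite -(ger0_norm (sqr_ge0 (v - c))) -(ger0_norm (sqr_ge0 (x r - c))) !normrX ler_pXn2r ?nnegrE.
Qed.

(** Real and imaginary parts may have different witnesses in [U]; the sum over [U] covers both. *)
Lemma cmedian_sqn_le n (x : 'I_n -> R[i]) (c : R[i]) (U : {set 'I_n}) : odd n ->
  (#|~: U| <= n./2)%N ->
  sqn (cmedian [seq x r | r <- enum 'I_n] - c) <= \sum_(r in U) sqn (x r - c).
Proof.
move=> on Un.
have dR (z w : R[i]) : complex.Re (z - w) = complex.Re z - complex.Re w by case: z w => [? ?] [].
have dI (z w : R[i]) : complex.Im (z - w) = complex.Im z - complex.Im w by case: z w => [? ?] [].
rewrite /sqn dR dI /cmedian /= -[map (@complex.Re R) _]map_comp -[map (@complex.Im R) _]map_comp.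
under [leRHS]eq_bigr do rewrite dR dI.
rewrite big_split/=; apply: lerD.
  exact: (median_sqr_le (fun r => complex.Re (x r)) (complex.Re c) on Un).
exact: (median_sqr_le (fun r => complex.Im (x r)) (complex.Im c) on Un).
Qed.

End median.

(** * Counting draws of generating vectors *)

Section draws.

Definition zpos (d N : nat) : {set d.-tuple 'I_N} :=
  [set z : d.-tuple 'I_N | [forall j, (0 < (tnth z j : 'I_N))%N]]%SET.

(** The difference [m - h] lies in the dual lattice of [z]: the exponentials of [h] and [m] agree at
    all points [k z / N]. *)
Definition aliased d N (z : d.-tuple 'I_N) (h m : d.-tuple int) : bool :=
  (N%:Z %| \sum_(j < d) (tnth m j - tnth h j) * (tnth z j : nat)%:Z)%Z.

Lemma card_zpos_gt0 d N : (1 < N)%N -> (0 < #|zpos d N|)%N.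
Proof.
move=> N1; apply/card_gt0P; exists [tuple Ordinal N1 | j < d].
by rewrite inE; apply/forallP => j; rewrite tnth_mktuple.
Qed.

Lemma card_ord_pos N : (0 < N)%N -> #|[set v : 'I_N | (0 < v)%N]%SET| = N.-1.
Proof.
case: N => // n _; rewrite (_ : [set v | _] = ~: [set ord0])%SET ?cardsC1 ?card_ord//.
by apply/setP => v; rewrite !inE lt0n -val_eqE.
Qed.

(* Altering coordinate [j] of an aliased vector arbitrarily is injective, as [N | l.z] determines [z_j]. *)
Lemma card_aliased d N (h m : d.-tuple int) (j : 'I_d) : prime N ->
  ~~ (N%:Z %| tnth m j - tnth h j)%Z ->
  (N.-1 * #|[set z in zpos d N | aliased z h m]%SET| <= #|zpos d N|)%N.
Proof.
move=> pN Nj; have N0 := prime_gt0 pN.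
rewrite -(card_ord_pos N0) -cardsX.
pose g (p : 'I_N * d.-tuple 'I_N) := [tuple if i == j then p.1 else tnth p.2 i | i < d].
rewrite -(card_in_imset (f := g)); last first.
  move=> [v z] [v' z']; rewrite !inE /= => /andP[_ /andP[_ az]] /andP[_ /andP[_ az']] E.
  have Ei i := congr1 (fun t => tnth t i) E.
  have vv : v = v' by have := Ei j; rewrite !tnth_mktuple eqxx.
  have zi i : i != j -> tnth z i = tnth z' i.
    by move=> /negbTE ij; have := Ei i; rewrite !tnth_mktuple ij.
  rewrite vv; congr pair; apply: eq_from_tnth => i.
  have [->|/zi//] := eqVneq i j.
  have : (N%:Z %| (tnth m j - tnth h j) * ((tnth z j : nat)%:Z - (tnth z' j : nat)%:Z))%Z.
    have := rpredB az az'; rewrite -sumrB (bigD1 j)//= big1 ?addr0 -?mulrBr//.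
    by move=> k kj; rewrite zi// subrr.
  rewrite Gauss_dvdzr; last by rewrite coprimezE /= prime_coprime.
  rewrite -eqz_mod_dvd => /eqP; rewrite !modz_small ?lez_nat ?ltz_nat ?ltn_ord//.
  by case=> /ord_inj.
apply: subset_leq_card; apply/fintype.subsetP => _ /imsetP[[v z]] /[swap] -> /=.
rewrite !inE /= => /andP[v0 /andP[/forallP z0 _]]; apply/forallP => i.
by rewrite tnth_mktuple; case: ifP.
Qed.

(** Independence of the [z_r] in counting form, by distributivity and the bijection between tuples
    and finite functions. *)
Lemma sum_draws_prod (R : comPzSemiRingType) d N n (F : 'I_n -> d.-tuple 'I_N -> R) :
  \sum_(z in draws d N n) \prod_(r < n) F r (tnth z r) =
  \prod_(r < n) \sum_(z in zpos d N) F r z.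
Proof.
rewrite bigA_distr_big.
pose g (t : n.-tuple (d.-tuple 'I_N)) : {ffun 'I_n -> d.-tuple 'I_N} := [ffun r => tnth t r].
pose g' (f : {ffun 'I_n -> d.-tuple 'I_N}) := [tuple f r | r < n].
rewrite [RHS](reindex g); last first.
  exists g' => [t _|f _]; first by apply: eq_from_tnth => r; rewrite tnth_mktuple ffunE.
  by apply/ffunP => r; rewrite ffunE tnth_mktuple.
apply: eq_big => [t|t _]; last by apply: eq_bigr => r _; rewrite ffunE.
rewrite inE; apply/forallP/ffun_onP => H r; first by rewrite ffunE inE.
by have := H r; rewrite ffunE inE.
Qed.

Lemma card_draws (R : comPzSemiRingType) d N n :
  #|draws d N n|%:R = #|zpos d N|%:R ^+ n :> R.
Proof.
have := @sum_draws_prod R d N n (fun _ _ => 1).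
under eq_bigr do rewrite big1//.
by rewrite !sumr_const prodr_const card_ord.
Qed.

(** The law of a single [z_r]: in the product formula the factors at other indices are 1, and their
    sums cancel against the normalization. *)
Lemma sum_draws_tnth (R : numFieldType) d N n (r : 'I_n) (F : d.-tuple 'I_N -> R) :
  (1 < N)%N ->
  (#|draws d N n|%:R)^-1 * \sum_(z in draws d N n) F (tnth z r) =
  (#|zpos d N|%:R)^-1 * \sum_(z in zpos d N) F z.
Proof.
move=> N1; have z0 : (#|zpos d N|%:R : R) != 0 by rewrite pnatr_eq0 -lt0n card_zpos_gt0.
have := sum_draws_prod (fun s z => if s == r then F z else 1).
under eq_bigr => z _.
  rewrite (bigD1 r)//= eqxx big1 ?mulr1; last by move=> s /negbTE ->.
  over.
move=> ->; rewrite (bigD1 r)//= eqxx.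
rewrite [X in _ * (_ * X) = _](eq_bigr (fun=> #|zpos d N|%:R)); last first.
  by move=> s sr; under eq_bigr do rewrite (negbTE sr); rewrite sumr_const.
rewrite prodr_const cardC1 card_ord card_draws; case: n r => [[]//|n] r /=.
by rewrite exprS invfM mulrACA mulVf ?expf_neq0// mulr1.
Qed.

Lemma draws_majority (R : realFieldType) d N n (bad : pred (d.-tuple 'I_N)) (p : R) :
  (1 < N)%N -> 0 < p -> p <= 1 ->
  \sum_(z in zpos d N) (bad z)%:R <= p * #|zpos d N|%:R ->
  (#|draws d N n|%:R)^-1 *
    \sum_(z in draws d N n) (n./2 < #|[set r | bad (tnth z r)]%SET|)%N%:R
  <= 2 ^+ n * p ^+ (n./2).+1.
Proof.
move=> N1 p0 p1 badp.
have Z0 : 0 < (#|zpos d N|%:R : R) by rewrite ltr0n card_zpos_gt0.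
have D0 : 0 < (#|draws d N n|%:R : R) by rewrite card_draws exprn_gt0.
rewrite ler_pdivrMl//.
(* Markov's inequality for the weight [p^-1] per bad draw. *)
pose w z : R := if bad z then p^-1 else 1.
(* Weight [p^-1] falls on a proportion at most [p] of the vectors and weight 1 on the rest, so the
   mean weight is at most 2. *)
have wsum : \sum_(z in zpos d N) w z <= 2 * #|zpos d N|%:R.
  have -> : 2 * #|zpos d N|%:R = p^-1 * (p * #|zpos d N|%:R) + #|zpos d N|%:R :> R.
    by rewrite mulKf ?gt_eqF//; ring.
  apply: le_trans (lerD (ler_wpM2l (ltW _) badp) (lexx _)); last by rewrite invr_gt0.
  rewrite mulr_sumr -[X in _ + X]sumr_const -big_split; apply: ler_sum => z _.
  rewrite /w; case: (bad z); rewrite /= ?mulr1 ?mulr0 ?add0r//.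
  by rewrite lerDl.
(* With at least [n./2 + 1] bad draws the product of the weights is at least [p^-(n./2 + 1)], as
   [p <= 1]. *)
apply: (@le_trans _ _ (\sum_(z in draws d N n) p ^+ (n./2).+1 * \prod_(r < n) w (tnth z r))).
  apply: ler_sum => z _; have w0 r : 0 <= w (tnth z r).
    by rewrite /w; case: ifP => // _; rewrite invr_ge0 ltW.
  case: ltnP => // B; last by rewrite mulr_ge0 ?prodr_ge0 ?exprn_ge0// ltW.
  have -> : \prod_(r < n) w (tnth z r) = p^-1 ^+ #|[set r | bad (tnth z r)]%SET|.
    rewrite /w -big_mkcond/= -prodr_const; apply: eq_bigl => r.
    by rewrite inE.
  rewrite exprVn -(subnK B) exprD invfM mulrCA mulfV ?expf_neq0 ?gt_eqF// mulr1.
  by rewrite invf_ge1 ?exprn_gt0// exprn_ile1// ltW.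
rewrite -mulr_sumr (sum_draws_prod (fun _ => w)) card_draws.
rewrite [leRHS](_ : _ = p ^+ (n./2).+1 * (2 * #|zpos d N|%:R) ^+ n); last first.
  by rewrite exprMn; ring.
rewrite ler_pM2l ?exprn_gt0//.
rewrite prodr_const card_ord lerXn2r ?nnegrE//.
by apply: sumr_ge0 => z _; rewrite /w; case: ifP => // _; rewrite invr_ge0 ltW.
Qed.

End draws.

(** * Cardinality of the hyperbolic cross *)

Section box_sums.
Variable R : realType.

(** The integers of modulus at most [K], ordered so that 0 splits off and both signs reduce to the
    same sum over [i.+1]. *)
Definition int_range (K : nat) : seq int :=
  0 :: [seq (i.+1)%:Z | i <- iota 0 K] ++ [seq - (i.+1)%:Z | i <- iota 0 K].

Lemma mem_int_range (K : nat) (k : int) : (`|k| <= K)%N -> k \in int_range K.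
Proof.
case: k => [[|n]|n] nK; rewrite inE ?eqxx// mem_cat; apply/or3P; [apply: Or32|apply: Or33].
  by apply/mapP; exists n; rewrite // mem_iota.
by apply/mapP; exists n; rewrite ?NegzE // mem_iota.
Qed.

Definition box_pt d (s : seq int) (f : {ffun 'I_d -> 'I_(size s)}) : d.-tuple int :=
  [tuple tnth (in_tuple s) (f j) | j < d].

Lemma box_ptP d (s : seq int) (h : d.-tuple int) :
  (forall j, tnth h j \in s) -> exists f : {ffun 'I_d -> 'I_(size s)}, box_pt f = h.
Proof.
move=> hs; have hi j : (index (tnth h j) s < size s)%N by rewrite index_mem.
exists [ffun j => Ordinal (hi j)]; apply: eq_from_tnth => j.
by rewrite tnth_mktuple ffunE (tnth_nth 0) /= nth_index.
Qed.

(** Expanding the product gives a sum of nonnegative terms over all index functions of the box.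
    Every [h] in [J] comes from at least one of them, and none serves two different [h]. *)
Lemma sum_box_prod_le d (s : seq int) (J : seq (d.-tuple int)) (w : 'I_d -> int -> R) :
  uniq J -> (forall h, h \in J -> forall j, tnth h j \in s) ->
  (forall j k, 0 <= w j k) ->
  \sum_(h <- J) \prod_(j < d) w j (tnth h j) <= \prod_(j < d) \sum_(k <- s) w j k.
Proof.
move=> uJ Js w0; pose F (h : d.-tuple int) := \prod_(j < d) w j (tnth h j).
have F0 h : 0 <= F h by apply: prodr_ge0.
under [leRHS]eq_bigr do rewrite big_tnth.
rewrite bigA_distr_bigA.
rewrite [leRHS](eq_bigr (fun f => F (box_pt f))); last first.
  by move=> f _; apply: eq_bigr => j _; rewrite tnth_mktuple.
apply: (@le_trans _ _ (\sum_(h <- J) \sum_(f : {ffun 'I_d -> 'I_(size s)})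
    (box_pt f == h)%:R * F (box_pt f))).
  rewrite big_seq [leRHS]big_seq; apply: ler_sum => h hJ.
  have [f fh] := box_ptP (Js h hJ).
  rewrite (bigD1 f)//= fh eqxx mul1r lerDl; apply: sumr_ge0 => f' _.
  by rewrite mulr_ge0.
rewrite exchange_big /=; apply: ler_sum => f _.
rewrite -mulr_suml -[leRHS]mul1r ler_wpM2r// -natr_sum.
rewrite (_ : (\sum_(h <- J) _)%N = count_mem (box_pt f) J).
  by rewrite count_uniq_mem//; case: (_ \in _).
by rewrite -sum1_count [RHS]big_mkcond; apply: eq_bigr => h _; rewrite /= eq_sym; case: (_ == _).
Qed.

(* Telescoping: [mu (k+1)^(-1-mu) <= k^(-mu) - (k+1)^(-mu)]. *)
Lemma sum_powR_le (mu : R) (K : nat) : 0 < mu ->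
  \sum_(i < K) ((i.+1)%:R `^ (1 + mu))^-1 <= 1 + mu^-1.
Proof.
move=> mu0; case: K => [|K]; first by rewrite big_ord0 addr_ge0// invr_ge0 ltW.
suff H : \sum_(i < K.+1) ((i.+1)%:R `^ (1 + mu))^-1 <= 1 + mu^-1 * (1 - ((K.+1)%:R `^ mu)^-1).
  by apply: le_trans H _; rewrite lerD2l -[leRHS]mulr1 ler_wpM2l ?invr_ge0 ?(ltW mu0)//.
elim: K => [|K IH].
  by rewrite big_ord_recl big_ord0 !powR1 invr1 subrr mulr0 !addr0.
rewrite big_ord_recr /=; apply: le_trans (lerD IH (lexx _)) _.
set a : R := (K.+1)%:R; set b : R := (K.+2)%:R.
suff : (b `^ (1 + mu))^-1 <= mu^-1 * ((a `^ mu)^-1 - (b `^ mu)^-1).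
  rewrite -subr_ge0 => H; rewrite -subr_ge0; apply: le_trans H _.
  by rewrite le_eqVlt; apply/orP; left; apply/eqP; ring.
have a0 : 0 < a by rewrite ltr0n.
have b0 : 0 < b by rewrite ltr0n.
have ba : a = b - 1 by rewrite /a /b -[K.+2%:R]natr1 addrK.
have am : 0 < a `^ mu by rewrite powR_gt0.
have bm : 0 < b `^ mu by rewrite powR_gt0.
rewrite ler_pdivlMl// powRD; last by rewrite (gt_eqF b0) implybT.
rewrite powRr1 ?(ltW b0)//.
rewrite invfM mulrA; set X := (b `^ mu)^-1.
have -> : (a `^ mu)^-1 = X * (b / a) `^ mu.
  rewrite /X powRM ?invr_ge0 ?(ltW a0) ?(ltW b0)// mulKf ?gt_eqF//.
  by rewrite -powRN -[a^-1]powR_inv1 ?(ltW a0)// -powRrM mulN1r.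
rewrite -[X in _ - X]mulr1 -mulrBr mulrC ler_wpM2l ?invr_ge0 ?(ltW bm)//.
rewrite lerBrDr.
(* Here [(b/a)^mu = exp(mu ln(b/a)) >= 1 + mu ln(b/a)], and [ln(b/a) = - ln(1 - 1/b) >= 1/b]. *)
apply: le_trans (_ : 1 + mu * ln (b / a) <= _); last first.
  by rewrite /powR gt_eqF ?divr_gt0// expR_ge1Dx.
suff H : b^-1 <= ln (b / a) by rewrite addrC lerD2l ler_wpM2l// ltW.
rewrite -[b / a]invf_div lnV ?posrE ?divr_gt0// lerNr.
have -> : a / b = 1 + (- b^-1) by rewrite ba mulrBl mul1r mulfV ?gt_eqF.
by apply: le_ln1Dx; rewrite ltrN2 invf_lt1// /b ltr1n.
Qed.

End box_sums.

Section hyperbolic_cross.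
Variables (R : realType) (alpha : R) (gamma : nat -> R).
Hypothesis alpha0 : 0 < alpha.
Hypothesis gamma01 : forall j, 0 < gamma j <= 1.

Local Notation g j := (gamma j `^ (2 * alpha)^-1).
Local Notation M j k := (Num.max (`|k%:~R : R| `^ (2 * alpha) / gamma j) 1).

Let alpha2 : 0 < 2 * alpha. Proof. by rewrite mulr_gt0. Qed.

Lemma weight_root_le1 j : g j <= 1.
Proof.
have /andP[g0 g1] := gamma01 j; rewrite [leRHS](_ : _ = 1 `^ (2 * alpha)^-1); last by rewrite powR1.
by apply: ge0_ler_powR; rewrite ?nnegrE ?invr_ge0 ?(ltW alpha2) ?(ltW g0).
Qed.

Lemma r_weight_ge1 d (h : d.-tuple int) : 1 <= r_weight alpha gamma h.
Proof.
rewrite /r_weight; elim/big_ind: _ => [//|x y x1 y1|j _]; last by rewrite le_max lexx orbT.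
by rewrite -[1]mulr1 ler_pM.
Qed.

(** All factors of [r_weight] are at least 1, so the [j]-th alone is at most [L^(2 alpha)]; then a
    root is taken. *)
Lemma A_set_coord d (L : R) (h : d.-tuple int) j : 0 <= L ->
  A_set d alpha gamma L h -> `|(tnth h j)%:~R : R| <= g j * L.
Proof.
move=> L0 hA; have /andP[g0 g1] := gamma01 j.
have : `|(tnth h j)%:~R : R| `^ (2 * alpha) <= gamma j * L `^ (2 * alpha).
  rewrite -ler_pdivrMl// mulrC; apply: le_trans hA; rewrite /r_weight (bigD1 j)//=.
  apply: (@le_trans _ _ (M j (tnth h j))); first by rewrite le_max lexx.
  rewrite -[leLHS]mulr1 ler_wpM2l//; first by rewrite le_max ler01 orbT.
  elim/big_ind: _ => [//|x y x1 y1|i _]; last by rewrite le_max lexx orbT.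
  by rewrite -[1]mulr1 ler_pM.
have K (x : R) : 0 <= x -> (x `^ (2 * alpha)) `^ (2 * alpha)^-1 = x.
  by move=> x0; rewrite -powRrM mulfV ?gt_eqF// powRr1.
move=> H; rewrite -[leLHS]K// -[in leRHS](K L)// -powRM ?powR_ge0 ?(ltW g0)//.
by apply: ge0_ler_powR; rewrite ?nnegrE ?invr_ge0 ?(ltW alpha2) ?mulr_ge0 ?powR_ge0 ?(ltW g0).
Qed.

Lemma A_set_box d (L : R) (h : d.-tuple int) : 0 <= L ->
  A_set d alpha gamma L h -> forall j, tnth h j \in int_range (Num.truncn L).
Proof.
move=> L0 hA j; apply: mem_int_range; rewrite truncn_ge_nat//.
apply: le_trans (_ : `|(tnth h j)%:~R : R| <= _); first by rewrite -intr_norm.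
apply: le_trans (A_set_coord j L0 hA) _.
by rewrite -[leRHS]mul1r ler_wpM2r// weight_root_le1.
Qed.

Lemma finite_A_set d (L : R) : 0 <= L -> finite_set (A_set d alpha gamma L).
Proof.
move=> L0; pose s := int_range (Num.truncn L).
apply: (@sub_finite_set _ _ (range (@box_pt d s))); last exact: finite_image.
move=> h hA; have [f fh] := box_ptP (A_set_box L0 hA); by exists f.
Qed.

(** Rankin's trick: on [A_d(L)] one has [1 <= L^(1+mu) r(h)^(-th)] with [th = (1+mu)/(2 alpha)], and
    the sum of the right-hand sides over a box factorizes. Each factor is at most
    [1 + 2 g_j (1 + 1/mu)], a factor of [P_N] because [1/mu = tau ln N]. *)
Lemma card_A_set_le d (N : nat) (tau L : R) (J : seq (d.-tuple int)) :
  (1 < N)%N -> 0 < tau -> 0 < L -> L <= N%:R -> uniq J ->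
  (forall h, h \in J -> A_set d alpha gamma L h) ->
  (size J)%:R <= L * (expR tau^-1 * P_fun d alpha gamma N tau).
Proof.
move=> N1 tau0 L0 LN uJ JA.
have lnN : 0 < ln (N%:R : R) by rewrite ln_gt0// ltr1n.
(* The sum is taken with exponent [1 + mu], where [L^mu <= N^mu = exp(1/tau)]. *)
pose mu := (tau * ln N%:R)^-1; have mu0 : 0 < mu by rewrite invr_gt0 mulr_gt0.
pose th := (1 + mu) / (2 * alpha).
have th0 : 0 < th by rewrite divr_gt0// addr_gt0.
pose w j k : R := (M j k `^ th)^-1.
have w0 j k : 0 <= w j k by rewrite invr_ge0 powR_ge0.
have M1 j k : 1 <= M j k by rewrite le_max lexx orbT.
have M0 j k : 0 <= M j k := le_trans ler01 (M1 j k).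
have powR_prod h : r_weight alpha gamma h `^ th = \prod_(j < d) M j (tnth h j) `^ th.
  rewrite /r_weight.
  suff : 0 <= \prod_(j < d) M j (tnth h j) /\
    (\prod_(j < d) M j (tnth h j)) `^ th = \prod_(j < d) M j (tnth h j) `^ th by case.
  elim/big_ind2: _ => [|x x' y y' [x0 <-] [y0 <-]|j _]; rewrite ?powR1 ?ler01//.
  by rewrite mulr_ge0// powRM.
have one_le h : h \in J -> 1 <= L `^ (1 + mu) * \prod_(j < d) w j (tnth h j).
  move=> hJ; rewrite prodfV -powR_prod ler_pdivlMr; last first.
    by rewrite powR_gt0// (lt_le_trans ltr01 (r_weight_ge1 _)).
  rewrite mul1r; have := JA _ hJ; rewrite /A_set /= => H.
  apply: (@le_trans _ _ ((L `^ (2 * alpha)) `^ th)).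
    by apply: ge0_ler_powR; rewrite ?nnegrE ?(ltW th0) ?powR_ge0// (le_trans ler01 (r_weight_ge1 _)).
  by rewrite -powRrM /th mulrCA mulfV ?gt_eqF// mulr1.
have wpos j (i : nat) (k : int) : `|k%:~R : R| = i.+1%:R ->
    w j k <= g j * ((i.+1)%:R `^ (1 + mu))^-1.
  move=> ki; have /andP[g0 g1] := gamma01 j.
  have i0 : 0 < (i.+1)%:R :> R by rewrite ltr0n.
  apply: (@le_trans _ _ ((((i.+1)%:R `^ (2 * alpha)) / gamma j) `^ th)^-1).
    rewrite lef_pV2 ?posrE ?powR_gt0 ?divr_gt0 ?powR_gt0//; last by rewrite (lt_le_trans ltr01).
    apply: ge0_ler_powR; rewrite ?nnegrE ?(ltW th0) ?M0//.
      by rewrite divr_ge0 ?powR_ge0 ?ltW.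
    by rewrite ki le_max lexx.
  rewrite powRM ?powR_ge0 ?invr_ge0 ?(ltW g0)// -powRrM /th [2 * alpha * _]mulrCA mulfV ?gt_eqF// mulr1.
  rewrite invfM mulrC ler_wpM2r ?invr_ge0 ?powR_ge0//.
  rewrite -[(gamma j)^-1]powR_inv1 ?(ltW g0)// -powRrM mulN1r powRN invrK.
  (* As [gamma_j <= 1], raising the exponent from [1/(2 alpha)] to [th] can only decrease the
     power. *)
  apply: ger_powR; rewrite ?g0//.
  by rewrite -[leLHS]mul1r ler_wpM2r ?invr_ge0 ?(ltW alpha2)// lerDl ltW.
have wsum j : \sum_(k <- int_range (Num.truncn L)) w j k <=
    1 + 2 * g j * (1 + tau * ln N%:R).
  rewrite /int_range big_cons big_cat !big_map /=.
  have -> : w j 0 = 1.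
    by rewrite /w normr0 powR0 ?gt_eqF// mul0r max_r ?powR1 ?invr1// ler01.
  rewrite lerD2l; set K := Num.truncn L.
  have S (e : nat -> int) : (forall i, `|(e i)%:~R : R| = i.+1%:R) ->
      \sum_(i <- iota 0 K) w j (e i) <= g j * (1 + tau * ln N%:R).
    move=> he; apply: (@le_trans _ _ (\sum_(i <- iota 0 K) g j * ((i.+1)%:R `^ (1 + mu))^-1)).
      by apply: ler_sum => i _; exact: wpos.
    rewrite -mulr_sumr ler_wpM2l ?powR_ge0// -/(index_iota 0 K).
    have := sum_powR_le K mu0; rewrite /mu invrK.
    by rewrite -(big_mkord xpredT (fun i => (i.+1%:R `^ (1 + (tau * ln N%:R)^-1))^-1)) /index_iota subn0.
  rewrite [leRHS](_ : _ = g j * (1 + tau * ln N%:R) + g j * (1 + tau * ln N%:R)); last by ring.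
  apply: lerD; apply: S => i; first by rewrite ger0_norm.
  by rewrite mulrNz normrN ger0_norm.
have Lmu : L `^ (1 + mu) <= L * expR tau^-1.
  rewrite powRD ?(gt_eqF L0) ?implybT// powRr1 ?(ltW L0)// ler_wpM2l ?(ltW L0)//.
  rewrite /powR gt_eqF// ler_expR.
  apply: (@le_trans _ _ (mu * ln N%:R)); last by rewrite /mu invfM -mulrA mulVf ?mulr1// gt_eqF.
  by rewrite ler_wpM2l ?(ltW mu0)// ler_ln ?posrE// ltr0n (ltn_trans _ N1).
apply: (@le_trans _ _ (\sum_(h <- J) L `^ (1 + mu) * \prod_(j < d) w j (tnth h j))).
  rewrite -sum1_size natr_sum big_seq [leRHS]big_seq; exact: ler_sum.
rewrite -mulr_sumr mulrA.
apply: ler_pM => //; first exact: powR_ge0.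
  by apply: sumr_ge0 => h _; apply: prodr_ge0.
apply: le_trans (@sum_box_prod_le _ _ (int_range (Num.truncn L)) J w uJ _ w0) _.
  by move=> h hJ j; apply: A_set_box (JA _ hJ) _; exact: ltW.
rewrite /P_fun; apply: ler_prod => j _; rewrite wsum andbT.
by apply: sumr_ge0 => k _.
Qed.
End hyperbolic_cross.

(** * Korobov functions *)

Section korobov_functions.
Variables (R : realType) (d : nat).
Implicit Types (f : d.-tuple R -> R[i]) (x : d.-tuple R) (h m : d.-tuple int).

Lemma periodic_shift f x (k : 'I_d -> int) : Defs.periodic f ->
  f [tuple tnth x j + (k j)%:~R | j < d] = f x.
Proof.
move=> pf.
have one i (n : int) u : f [tuple tnth u j + (if j == i then n else 0)%:~R | j < d] = f u.
  have nat_shift (n' : nat) y : f [tuple tnth y j + (if j == i then n'%:Z else 0)%:~R | j < d] = f y.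
    elim: n' y => [|n' IH] y.
      congr f; apply: eq_from_tnth => j; rewrite tnth_mktuple.
      by case: ifP; rewrite addr0.
    rewrite -[RHS](pf i) -[RHS]IH; congr f; apply: eq_from_tnth => j; rewrite !tnth_mktuple.
    by case: ifP => _; rewrite ?addr0// -addrA; congr (_ + _); rewrite -[n'.+1]add1n PoszD intrD.
  case: n => n; first exact: nat_shift.
  rewrite -(nat_shift n.+1); congr f; apply: eq_from_tnth => j; rewrite !tnth_mktuple.
  by case: ifP => _; rewrite ?addr0// NegzE mulrNz subrK.
suff H (s : seq 'I_d) : uniq s ->
    f [tuple tnth x j + (if j \in s then k j else 0)%:~R | j < d] = f x.
  rewrite -(H (enum 'I_d) (enum_uniq _)); congr f; apply: eq_from_tnth => j.
  by rewrite !tnth_mktuple mem_enum.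
elim: s => [|i s IH] /=.
  move=> _; congr f; apply: eq_from_tnth => j; by rewrite tnth_mktuple addr0.
move=> /andP[si us]; rewrite -IH// -[RHS](one i (k i)); congr f; apply: eq_from_tnth => j.
rewrite !tnth_mktuple inE; have [->|ji] := eqVneq j i; first by rewrite (negbTE si) addr0.
by rewrite addr0.
Qed.

Lemma periodic_frac f x : Defs.periodic f -> f [tuple Defs.frac (tnth x j) | j < d] = f x.
Proof.
move=> pf; rewrite -(periodic_shift x (fun j => - Num.floor (tnth x j)) pf); congr f.
by apply: eq_from_tnth => j; rewrite !tnth_mktuple mulrNz.
Qed.

Lemma dotp_add_int h x (k : 'I_d -> int) : exists n : int,
  dotp h [tuple tnth x j + (k j)%:~R | j < d] = dotp h x + n%:~R.
Proof.
exists (\sum_(j < d) tnth h j * k j); rewrite /dotp rmorph_sum -big_split; apply: eq_bigr => j _.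
by rewrite tnth_mktuple mulrDr /= intrM.
Qed.

Lemma cexp2pi_dotp_frac h x :
  cexp2pi (dotp h [tuple Defs.frac (tnth x j) | j < d]) = cexp2pi (dotp h x).
Proof.
have [n E] := dotp_add_int h x (fun j => - Num.floor (tnth x j)).
rewrite -[RHS]mulr1 -(cexp2pi_int R n) -cexp2piD -E; congr (cexp2pi (dotp _ _)).
by apply: eq_from_tnth => j; rewrite !tnth_mktuple mulrNz.
Qed.

Lemma frac_ge0_le1 (t : R) : 0 <= Defs.frac t <= 1.
Proof.
have /andP[] := floor_itv t; rewrite /Defs.frac intrD => a b; rewrite subr_ge0 a /=.
by rewrite lerBlDr addrC ltW.
Qed.

Lemma esum_fset_le (F : d.-tuple int -> R) (M : R) (J : {fset d.-tuple int}) :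
  (\esum_(h in [set: d.-tuple int]) (F h)%:E <= M%:E)%E -> \sum_(h <- J) F h <= M.
Proof.
move=> FM; rewrite -lee_fin; apply: le_trans FM; apply: esum_ge; exists [set` J] => //.
by rewrite -fsbig_seq ?fset_uniq// sumEFin.
Qed.

Lemma korobov_sum_le alpha gamma f (J : {fset d.-tuple int}) :
  (korobov_norm alpha gamma f <= 1)%E ->
  \sum_(h <- J) sqn (fourier_coef f h) * r_weight alpha gamma h <= 1.
Proof.
move=> fN; apply: esum_fset_le; under eq_esum do rewrite -cabs_sqr.
move: fN; rewrite /korobov_norm; set S := (\esum_(h in _) _)%E => fN.
have S0 : (0 <= S)%E.
  apply: esum_ge0 => h _; rewrite lee_fin mulr_ge0 ?sqr_ge0//.
  by apply: prodr_ge0 => j _; rewrite le_max ler01 orbT.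
rewrite leNgt; apply/negP => S1; move: fN; apply/negP; rewrite -ltNge.
case: S S0 S1 => [s| |]// s0 s1; last by rewrite poweRyr ?ltry// invr_neq0.
rewrite poweR_EFin lte_fin; rewrite !lte_fin in s1.
rewrite [ltLHS](_ : _ = 1 `^ (2^-1)); last by rewrite powR1.
by rewrite gt0_ltr_powR ?nnegrE ?invr_gt0// ltW.
Qed.

(** The set [J] attains the supremum of the finite sums up to [e], so a disjoint [K] can add no more
    than [e]. *)
Lemma fset_tail (F : d.-tuple int -> R) (e : R) : (forall h, 0 <= F h) -> 0 < e ->
  (\esum_(h in [set: d.-tuple int]) (F h)%:E < +oo)%E ->
  exists J : {fset d.-tuple int}, forall K : {fset d.-tuple int},
    (forall h, h \in K -> h \notin J) -> \sum_(h <- K) F h <= e.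
Proof.
move=> F0 e0 FS; set S := (\esum_(h in _) _)%E in FS.
have S0 : (0 <= S)%E by apply: esum_ge0 => h _; rewrite lee_fin.
have Sfin : S \is a fin_num by rewrite ge0_fin_numE.
pose A := [set y | exists J : {fset d.-tuple int}, y = \sum_(h <- J) F h].
have bA : ubound A (fine S).
  by move=> _ [J ->]; apply: esum_fset_le; rewrite fineK.
have supA : has_sup A.
  by split; [exists 0, fset0; rewrite big_nil | exists (fine S)].
have [_ [J ->] HJ] := sup_adherent e0 supA.
exists J => K KJ.
have : \sum_(h <- (J `|` K)%fset) F h <= sup A.
  by apply: sup_upper_bound => //; exists (J `|` K)%fset.
rewrite (perm_big (J ++ K)) /=; last first.
  apply: uniq_perm; rewrite ?fset_uniq//; last by move=> h; rewrite inE mem_cat.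
  rewrite cat_uniq !fset_uniq /= andbT; apply/hasPn => h /KJ; exact.
by rewrite big_cat /=; move: HJ; rewrite ltrBlDr; lra.
Qed.

Lemma sum_fsubset_diff (V : zmodType) (F : d.-tuple int -> V) (J K : {fset d.-tuple int}) :
  (J `<=` K)%fset -> \sum_(h <- K) F h = \sum_(h <- J) F h + \sum_(h <- (K `\` J)%fset) F h.
Proof.
move=> JK; rewrite -big_cat /=; apply: perm_big; apply: uniq_perm; rewrite ?fset_uniq//.
  by rewrite cat_uniq !fset_uniq /= andbT; apply/hasPn => h; rewrite inE => /andP[].
move=> h; rewrite mem_cat inE; case: (boolP (h \in J)) => //= hJ.
by rewrite (fsubsetP JK).
Qed.

(** Absolute convergence gives a [J], chosen before [x], off which finite sums of moduli are at most
    [e / 2]. For each [x] a further finite set [Jx] brings the partial sum within [e / 2] of the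
    value of [f], and the frequencies it adds lie outside [J]. *)
Lemma korobov_trigpoly alpha gamma f (A : {fset d.-tuple int}) (e : R) :
  korobov d alpha gamma f -> 0 < e ->
  exists K : {fset d.-tuple int}, (A `<=` K)%fset /\
    forall x, cabs (f x - trigpoly K (fourier_coef f) x) <= e.
Proof.
move=> [pf fS fsum _] e0; have e20 : 0 < e / 2 by rewrite divr_gt0.
have [J HJ] := fset_tail (fun h => cabs_ge0 (fourier_coef f h)) e20 fS.
exists (A `|` J)%fset; split; first exact: fsubsetUl.
set K := (A `|` J)%fset => x.
(* The series is known to represent [f] on the unit cube, so [x] is reduced to its fractional
   part. *)
set y := [tuple Defs.frac (tnth x j) | j < d].
have y01 j : 0 <= tnth y j <= 1 by rewrite tnth_mktuple frac_ge0_le1.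
have [Jx HJx] := fsum y y01 _ e20.
have := HJx (K `|` Jx)%fset (fsubsetUr _ _).
rewrite (sum_fsubset_diff _ (fsubsetUl K Jx)).
rewrite -(periodic_frac x pf) -/y.
have -> : trigpoly K (fourier_coef f) x = \sum_(h <- K) fourier_coef f h * cexp2pi (dotp h y).
  by apply: eq_bigr => h _; rewrite cexp2pi_dotp_frac.
set a := \sum_(h <- K) _; set b := \sum_(h <- _) _ => H.
have -> : f y - a = (f y - (a + b)) + b by ring.
apply: le_trans (cabsD _ _) _; rewrite [leRHS](splitr e); apply: lerD => //.
apply: le_trans (cabs_sum _ _ _) _.
under eq_bigr do rewrite cabsM cabs_cexp2pi mulr1.
by apply: HJ => h; rewrite !inE negb_or => /andP[/andP[]].
Qed.

End korobov_functions.

(** * Aliasing *)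

Section aliasing.
Variables (R : realType) (d N : nat).
Hypothesis N0 : (0 < N)%N.
Implicit Types (f : d.-tuple R -> R[i]) (Delta : d.-tuple R) (h m : d.-tuple int)
  (z : d.-tuple 'I_N).

Lemma dotp_lattice_pt h m z Delta (k : nat) :
  dotp m (lattice_pt z Delta k) - dotp h (lattice_pt z Delta k) =
  k%:R * ((\sum_(j < d) (tnth m j - tnth h j) * (tnth z j : nat)%:Z)%:~R / N%:R)
  + (dotp m Delta - dotp h Delta).
Proof.
rewrite /dotp -!sumrB rmorph_sum mulr_suml mulr_sumr -big_split; apply: eq_bigr => j _ /=.
rewrite !tnth_mktuple rmorphM rmorphB /=.
set a : R := (tnth m j)%:~R; set b : R := (tnth h j)%:~R.
rewrite -[((tnth z j : nat)%:Z)%:~R]/((tnth z j)%:R : R); ring.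
Qed.

(** The phase difference is affine in [k], and the character sum over [k] retains exactly the
    frequencies aliased to [h]. *)
Lemma lattice_rule_trigpoly (s : seq (d.-tuple int)) (c : d.-tuple int -> R[i]) h z Delta :
  N%:R^-1 * \sum_(k < N) trigpoly s c (lattice_pt z Delta k)
     * cexp2pi (- dotp h (lattice_pt z Delta k)) =
  \sum_(m <- s) (if aliased z h m then c m else 0) * cexp2pi (dotp m Delta - dotp h Delta).
Proof.
have Nc : (N%:R : R[i]) != 0 by rewrite pnatr_eq0 -lt0n.
under eq_bigr do rewrite /trigpoly mulr_suml.
rewrite exchange_big mulr_sumr; apply: eq_bigr => m _ /=.
under eq_bigr do rewrite -mulrA -cexp2piD dotp_lattice_pt cexp2piD.
rewrite -mulr_sumr -mulr_suml sum_cexp2pi_frac// natrM -/(aliased z h m).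
case: (aliased _ _ _); last by rewrite mulr0 !mul0r !mulr0.
by rewrite mulr1 mulrCA mulKf.
Qed.

(** The term [m = h] is left out because it reproduces the wanted coefficient. *)
Definition alias_coef (fh : d.-tuple int -> R[i]) z h m : R[i] :=
  if (m != h) && aliased z h m then fh m else 0.

Lemma lattice_error_le f (K : {fset d.-tuple int}) (e : R) h z Delta :
  Defs.periodic f -> h \in K ->
  (forall x, cabs (f x - trigpoly K (fourier_coef f) x) <= e) ->
  sqn (fhat_lattice f z Delta h - fourier_coef f h) <=
  2 * sqn (trigpoly K (alias_coef (fourier_coef f) z h) Delta) + 2 * e ^+ 2.
Proof.
move=> pf hK fe; set F := trigpoly K (fourier_coef f) in fe.
have e0 : 0 <= e by apply: le_trans (fe [tuple 0 | j < d]); exact: cabs_ge0.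
pose pt k := lattice_pt z Delta k.
(* [X] is the error of the rule on the trigonometric polynomial [F], and [Y] is the contribution of
   the uniformly small [f - F]. *)
pose X := N%:R^-1 * \sum_(k < N) F (pt k) * cexp2pi (- dotp h (pt k)) - fourier_coef f h.
pose Y := N%:R^-1 * \sum_(k < N) (f (pt k) - F (pt k)) * cexp2pi (- dotp h (pt k)).
have -> : fhat_lattice f z Delta h - fourier_coef f h = X + Y.
  rewrite /X /Y /fhat_lattice addrAC -mulrDr -big_split /=; congr (_ * _ - _).
  by apply: eq_bigr => k _; rewrite -mulrDl addrC subrK periodic_frac.
apply: le_trans (sqnD_le _ _) _; apply: lerD; rewrite ler_wpM2l//.
  (* A unimodular factor turns the aliasing sum into a trigonometric polynomial in [Delta], ready
     for Parseval. *)
  rewrite -[leLHS]mulr1 -(sqn_cexp2pi (dotp h Delta)) -sqnM /X lattice_rule_trigpoly.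
  rewrite le_eqVlt; apply/orP; left; apply/eqP; congr sqn.
  rewrite (bigD1_seq h)//= ?fset_uniq// subrr cexp2pi0 mulr1.
  have -> : aliased z h h.
    by rewrite /aliased big1 ?dvdz0// => j _; rewrite subrr mul0r.
  rewrite addrAC subrr add0r mulr_suml /trigpoly [RHS](bigD1_seq h)//= ?fset_uniq//.
  rewrite {1}/alias_coef eqxx mul0r add0r; apply: eq_bigr => m mh.
  by rewrite -mulrA -cexp2piD subrK /alias_coef mh.
apply: sqn_le_cabs => //; rewrite /Y cabsM.
have -> : cabs (N%:R^-1 : R[i]) = N%:R^-1.
  rewrite /cabs ComplexField.Normc.normcV; congr (_^-1).
  by rewrite normcMn ComplexField.Normc.normc1.
rewrite ler_pdivrMl ?ltr0n//; apply: le_trans (cabs_sum _ _ _) _.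
under eq_bigr do rewrite cabsM cabs_cexp2pi mulr1.
apply: (@le_trans _ _ (\sum_(k < N) e)); first by apply: ler_sum => k _.
by rewrite sumr_const card_ord mulr_natl.
Qed.

End aliasing.

(** * The squared L2 error for fixed draws *)

Section fixed_draw.
Variables (R : realType) (d N : nat) (alpha : R) (gamma : nat -> R) (tau : R).
Implicit Types (f : d.-tuple R -> R[i]).

Lemma L2norm_error_le f (nR : nat) (z : nR.-tuple (d.-tuple 'I_N))
    (Delta : nR.-tuple (d.-tuple R)) (K : {fset d.-tuple int}) (e : R) :
  let A := A_set d alpha gamma (N_star d alpha gamma N tau) in
  finite_set A -> (fset_set A `<=` K)%fset -> 0 <= e ->
  (forall x, cabs (f x - trigpoly K (fourier_coef f) x) <= e) ->
  (L2norm (fun x => f x - A_rand alpha gamma tau z Delta f x)%R ^+ 2 <=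
  (2 * (\sum_(m <- (K `\` fset_set A)%fset) sqn (fourier_coef f m) +
     \sum_(h <- fset_set A) sqn (fhat_med f z Delta h - fourier_coef f h)) + 2 * e ^+ 2)%:E)%E.
Proof.
move=> A finA AK e0 fe.
(* Coefficients of the error: the median error on [A], the full coefficient on the rest of [K]. What
   remains is the approximation error of [f], at most [e]. *)
pose c m := fourier_coef f m - (if m \in fset_set A then fhat_med f z Delta m else 0).
have fE x : sqn (f x - A_rand alpha gamma tau z Delta f x) <=
    2 * sqn (trigpoly K c x) + 2 * e ^+ 2.
  have -> : f x - A_rand alpha gamma tau z Delta f x =
      trigpoly K c x + (f x - trigpoly K (fourier_coef f) x).
    rewrite /A_rand fsbig_finite//= -/A.
    suff -> : trigpoly K (fourier_coef f) x = trigpoly K c x +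
        \sum_(h <- fset_set A) fhat_med f z Delta h * cexp2pi (dotp h x) by ring.
    rewrite /trigpoly !(sum_fsubset_diff _ AK) /c [RHS]addrAC -big_split/=; congr (_ + _).
      by apply: eq_big_seq => h hA; rewrite hA mulrBl subrK.
    by apply: eq_big_seq => h; rewrite inE => /andP[/negbTE -> _]; rewrite subr0.
  apply: le_trans (sqnD_le _ _) _; rewrite lerD2l ler_wpM2l//.
  exact: sqn_le_cabs.
have bc : bmeas (fun x : d.-tuple (measurableTypeR R) => 2 * sqn (trigpoly K c x) + 2 * e ^+ 2).
  by apply: bmeasD; [apply: bmeasM; [exact: bmeas_cst|exact: bmeas_trigpoly]|exact: bmeas_cst].
have -> : (2 * (\sum_(m <- (K `\` fset_set A)%fset) sqn (fourier_coef f m) +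
     \sum_(h <- fset_set A) sqn (fhat_med f z Delta h - fourier_coef f h)) + 2 * e ^+ 2)
    = \int[cube_unif R d]_x (2 * sqn (trigpoly K c x) + 2 * e ^+ 2).
  rewrite RintegralD//; last 2 first.
  - by apply: bmeas_integrable; apply: bmeasM; [exact: bmeas_cst|exact: bmeas_trigpoly].
  - exact: bmeas_integrable (bmeas_cst _).
  rewrite RintegralZl//; last exact: bmeas_integrable (bmeas_trigpoly _ _).
  rewrite Rintegral_cst_probability parseval ?fset_uniq//; congr (2 * _ + _).
  rewrite (sum_fsubset_diff _ AK) addrC /c; congr (_ + _); apply: eq_big_seq => h.
    by move=> ->; rewrite -[in RHS]sqnN opprB.
  by rewrite inE => /andP[/negbTE -> _]; rewrite subr0.
rewrite -integral_EFin_bmeas// /L2norm.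
have -> (y : \bar R) : (0 <= y)%E -> (y ^+ 2 = y `^ 2)%E.
  case: y => [y| |]// y0; first by rewrite -EFin_expe poweR_EFin powR_mulrn// -lee_fin.
  by rewrite poweRyr// expe2 mulyy.
  rewrite poweR_Lnorm//; apply: le_integral_nonmeasurable => x; first exact: poweR_ge0.
  rewrite gee0_abs ?lee_fin ?cabs_ge0// powR_mulrn ?cabs_ge0// cabs_sqr.
  exact: fE.
exact: Lnorm_ge0.
Qed.

End fixed_draw.

(** * Averaging over the generating vectors *)

Section averaging.
Variables (R : realType) (d N nR : nat).
Hypothesis prN : prime N.
(** These stand for [A_d(N_star)], [A_d(L)], the frequencies of the approximating polynomial, the
    Fourier coefficients and the ratio [L / N_star]. *)
Variables (A AL K : {fset d.-tuple int}) (fh : d.-tuple int -> R[i]) (p : R).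
Hypothesis ALA : (AL `<=` A)%fset.
Hypothesis A_distinct : forall h m, h \in A -> m \in A ->
  [forall j, (N%:Z %| tnth m j - tnth h j)%Z] -> m = h.
Hypothesis A_size : (#|` A| <= N.-1)%N.
Hypothesis p01 : 0 < p <= 1.
Hypothesis AL_size : #|` AL|%:R <= p * (N.-1)%:R.
Hypothesis fh_le1 : \sum_(m <- K) sqn (fh m) <= 1.

Let N1 : (1 < N)%N. Proof. exact: prime_gt1. Qed.
Let q : R := ((N.-1)%:R)^-1.
Let N1R : 0 < (N.-1)%:R :> R. Proof. by rewrite ltr0n -subn1 subn_gt0. Qed.
Let q0 : 0 <= q. Proof. by rewrite invr_ge0 ltW. Qed.

Definition zavg (F : d.-tuple 'I_N -> R) : R := (#|zpos d N|%:R)^-1 * \sum_(z in zpos d N) F z.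

Lemma zpos_pos : 0 < (#|zpos d N|%:R : R).
Proof. by rewrite ltr0n card_zpos_gt0. Qed.

Lemma zavg_le (F G : d.-tuple 'I_N -> R) : (forall z, F z <= G z) -> zavg F <= zavg G.
Proof.
by move=> FG; rewrite /zavg ler_wpM2l ?invr_ge0 ?(ltW zpos_pos)//; apply: ler_sum.
Qed.

Lemma zavg_sum (I : Type) (s : seq I) (P : pred I) (F : I -> d.-tuple 'I_N -> R) :
  zavg (fun z => \sum_(i <- s | P i) F i z) = \sum_(i <- s | P i) zavg (F i).
Proof. by rewrite /zavg exchange_big mulr_sumr. Qed.

Lemma zavgZ (c : R) (F : d.-tuple 'I_N -> R) : zavg (fun z => c * F z) = c * zavg F.
Proof. by rewrite /zavg -mulr_sumr mulrCA. Qed.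

Lemma zavg_cst (c : R) : zavg (fun=> c) = c.
Proof.
by rewrite /zavg sumr_const -[c *+ _]mulr_natl mulKf// gt_eqF// zpos_pos.
Qed.

(** If some coordinate of [m - h] is not divisible by [N], [card_aliased] gives probability at most
    [q = 1/(N-1)]; otherwise the bound 1 is used. *)
Lemma zavg_aliased_le h m :
  zavg (fun z => (aliased z h m)%:R) <= q + [forall j, (N%:Z %| tnth m j - tnth h j)%Z]%:R.
Proof.
case: (boolP [forall j, _]) => [_|].
  apply: (@le_trans _ _ (zavg (fun=> 1))).
    by apply: zavg_le => z; case: aliased.
  by rewrite zavg_cst lerDr.
rewrite negb_forall => /existsP[j Nj]; rewrite addr0 /zavg ler_pdivrMl ?zpos_pos//.
rewrite mulrC ler_pdivlMl// -natr_sum -natrM ler_nat.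
apply: leq_trans (card_aliased prN Nj); rewrite leq_mul2l; apply/orP; right.
rewrite -sum1_card big_mkcond [leqRHS]big_mkcond; apply: leq_sum => z _.
by rewrite !inE; case: ifP => //= _; case: aliased.
Qed.

Definition bad (z : d.-tuple 'I_N) h := has (fun m => (m != h) && aliased z h m) AL.

(** Union bound over [AL]: distinct members of [A] differ modulo [N], so each [m <> h] contributes
    at most [q]. *)
Lemma zavg_bad h : h \in A -> zavg (fun z => (bad z h)%:R) <= p.
Proof.
move=> hA; apply: (@le_trans _ _ (zavg (fun z => \sum_(m <- AL | m != h) (aliased z h m)%:R))).
  apply: zavg_le => z; rewrite /bad; case: hasP => [[m mAL /andP[mh am]]|_]; last first.
    by apply: sumr_ge0.
  by rewrite -big_filter (bigD1_seq m) ?mem_filter ?mh ?filter_uniq ?fset_uniq//= am lerDl sumr_ge0.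
rewrite zavg_sum; apply: (@le_trans _ _ (\sum_(m <- AL | m != h) q)).
  rewrite big_seq_cond [leRHS]big_seq_cond; apply: ler_sum => m /andP[mAL mh].
  apply: le_trans (zavg_aliased_le h m) _; case: (boolP [forall j, _]) => [E|_]; last by rewrite addr0.
  by move: mh; rewrite (A_distinct hA _ E) ?eqxx//; exact: (fsubsetP ALA).
rewrite big_mkcond; apply: (@le_trans _ _ (\sum_(m <- AL) q)).
  by apply: ler_sum => m _; case: ifP.
rewrite big_const_seq count_predT iter_addr_0 -mulr_natl ler_pdivrMr//.
Qed.

Definition alias_energy (z : d.-tuple 'I_N) h : R := \sum_(m <- K) sqn (alias_coef fh z h m).

Lemma alias_energy_ge0 z h : 0 <= alias_energy z h.
Proof. by apply: sumr_ge0 => m _; exact: sqn_ge0. Qed.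

Lemma alias_energy_le1 z h : alias_energy z h <= 1.
Proof.
apply: le_trans fh_le1; apply: ler_sum => m _; rewrite /alias_coef.
by case: ifP => // _; rewrite sqn0 sqn_ge0.
Qed.

Definition tail_energy (B : {fset d.-tuple int}) : R := \sum_(m <- (K `\` B)%fset) sqn (fh m).

(** For a good [z] only frequencies outside [AL] are aliased to [h]. Each such [m] is counted with
    total weight at most 2: [|A| q <= 1] from chance aliasing, and at most one [h] in [A] congruent
    to [m] modulo [N]. *)
Lemma sum_zavg_good :
  \sum_(h <- A) zavg (fun z => alias_energy z h * (~~ bad z h)%:R) <= 2 * tail_energy AL.
Proof.
have step h : zavg (fun z => alias_energy z h * (~~ bad z h)%:R) <=
    \sum_(m <- (K `\` AL)%fset) sqn (fh m) * (q + [forall j, (N%:Z %| tnth m j - tnth h j)%Z]%:R).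
  apply: (@le_trans _ _ (zavg (fun z => \sum_(m <- (K `\` AL)%fset) sqn (fh m) * (aliased z h m)%:R))).
    apply: zavg_le => z; case: (boolP (bad z h)) => [_|/hasPn nb].
      by rewrite mulr0; apply: sumr_ge0 => m _; rewrite mulr_ge0 ?sqn_ge0.
    rewrite mulr1 /alias_energy (bigID (fun m => m \in AL)) /=.
    rewrite big1_seq ?add0r; last first.
      move=> m /andP[mAL _]; rewrite /alias_coef.
      by have := nb m mAL; case: ifP => //; rewrite sqn0.
    rewrite [leRHS](perm_big [seq m <- K | m \notin AL]); last first.
      apply: uniq_perm; rewrite ?filter_uniq ?fset_uniq//.
      by move=> m; rewrite mem_filter inE.
    rewrite [leRHS]big_filter; apply: ler_sum => m _; rewrite /alias_coef.
    by case: eqP => _ /=; case: aliased; rewrite ?mulr0 ?mulr1 ?sqn0 ?sqn_ge0.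
  rewrite zavg_sum; apply: ler_sum => m _; rewrite zavgZ ler_wpM2l ?sqn_ge0//.
  exact: zavg_aliased_le.
apply: le_trans (ler_sum _ (fun h _ => step h)) _.
rewrite exchange_big /= /tail_energy mulr_sumr; apply: ler_sum => m _.
rewrite -mulr_sumr mulrC ler_wpM2r ?sqn_ge0// big_split /=; apply: lerD.
  rewrite big_const_seq count_predT iter_addr_0 -mulr_natl ler_pdivrMr// mul1r ler_nat.
  exact: A_size.
rewrite -natr_sum -[leRHS]/(1%:R) ler_nat.
pose cg h := [forall j, (N%:Z %| tnth m j - tnth h j)%Z].
suff : (\sum_(h <- A) cg h <= 1)%N by [].
have -> : (\sum_(h <- A) cg h = count cg A)%N.
  by rewrite -sum1_count [RHS]big_mkcond; apply: eq_bigr => h _; case: (cg h).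
rewrite -size_filter; set s := seq.filter _ _.
have us : uniq s by rewrite filter_uniq ?fset_uniq.
have : forall h h', h \in s -> h' \in s -> h = h'.
  move=> h h'; rewrite !mem_filter => /andP[/forallP mh hA] /andP[/forallP mh' h'A].
  apply: A_distinct => //; apply/forallP => j.
  have -> : tnth h j - tnth h' j = (tnth m j - tnth h' j) - (tnth m j - tnth h j) by ring.
  by rewrite rpredB.
case: s us => [|a [|b s]]//= /andP[] + _; rewrite inE negb_or => /andP[ab _] /(_ a b).
by rewrite !inE !eqxx orbT => /(_ isT isT) E; rewrite E eqxx in ab.
Qed.

Definition majority_bad (z : nR.-tuple (d.-tuple 'I_N)) h : bool :=
  (nR./2 < #|[set r | bad (tnth z r) h]%SET|)%N.

(** The median bound needs a set that omits at most half of the draws. When too many are bad all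
    draws are taken, at the price of the trivial energy bound 1. *)
Definition trusted (z : nR.-tuple (d.-tuple 'I_N)) h : {set 'I_nR} :=
  if majority_bad z h then [set: 'I_nR]%SET else [set r | ~~ bad (tnth z r) h]%SET.

Lemma card_trustedC z h : (#|~: trusted z h| <= nR./2)%N.
Proof.
rewrite /trusted /majority_bad; case: ltnP => B; first by rewrite finset.setCT cards0.
by apply: leq_trans B; apply: eq_leq; apply: eq_card => r; rewrite !inE negbK.
Qed.

Lemma draws_average_le (e : R) : 
  (#|draws d N nR|%:R)^-1 * \sum_(z in draws d N nR)
    (\sum_(h <- A) \sum_(r in trusted z h) (2 * alias_energy (tnth z r) h + 2 * e ^+ 2))
  <= 4 * nR%:R * tail_energy AL + 2 * nR%:R * (N.-1)%:R * (2 ^+ nR * p ^+ (nR./2).+1 + e ^+ 2).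
Proof.
have D0 : 0 < (#|draws d N nR|%:R : R) by rewrite card_draws exprn_gt0 ?zpos_pos.
pose good z h : R := alias_energy z h * (~~ bad z h)%:R.
(* With a bad majority each of the [nR] energies is at most 1; otherwise only good draws enter the
   sum. *)
have pt z h : \sum_(r in trusted z h) (2 * alias_energy (tnth z r) h + 2 * e ^+ 2) <=
    \sum_(r < nR) 2 * good (tnth z r) h + 2 * nR%:R * ((majority_bad z h)%:R + e ^+ 2).
  rewrite big_split /= mulrDr addrA; apply: lerD; last first.
    rewrite sumr_const -[_ *+ #|_|]mulr_natl [leLHS]mulrCA -mulrA ler_wpM2l//.
    by rewrite ler_wpM2r ?sqr_ge0// ler_nat -[leqRHS](card_ord nR) max_card.
  rewrite /trusted; case: (majority_bad z h) => /=.
    rewrite -[leLHS]add0r mulr1; apply: lerD.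
      by apply: sumr_ge0 => r _; rewrite !mulr_ge0 ?alias_energy_ge0.
    apply: (@le_trans _ _ (\sum_(r in [set: 'I_nR]%SET) 2)).
      by apply: ler_sum => r _; rewrite -[leRHS]mulr1 ler_wpM2l ?alias_energy_le1.
    by rewrite sumr_const cardsT card_ord mulr_natr.
  rewrite mulr0 addr0 big_mkcond; apply: ler_sum => r _; rewrite inE /good.
  by case: (bad _ _); rewrite /= ?mulr1 ?mulr0.
apply: (@le_trans _ _ (\sum_(h <- A) (\sum_(r < nR) 2 * zavg (fun z => good z h) +
    2 * nR%:R * (2 ^+ nR * p ^+ (nR./2).+1 + e ^+ 2)))).
  rewrite exchange_big mulr_sumr /= big_seq [leRHS]big_seq; apply: ler_sum => h hA.
  rewrite ler_pdivrMl//; apply: le_trans (ler_sum _ (fun z _ => pt z h)) _.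
  rewrite big_split /= mulrDr; apply: lerD.
    rewrite exchange_big mulr_sumr; apply: ler_sum => r _ /=.
    rewrite -mulr_sumr mulrCA ler_wpM2l// -ler_pdivrMl//.
    by rewrite (sum_draws_tnth r (fun z => good z h) N1).
  rewrite -mulr_sumr mulrCA ler_wpM2l ?mulr_ge0// big_split /= mulrDr; apply: lerD; last first.
    by rewrite sumr_const mulr_natl.
  rewrite -ler_pdivrMl//; have /andP[p0 p1] := p01.
  apply: (@draws_majority R d N nR (fun z => bad z h) p) => //.
  by rewrite mulrC -ler_pdivrMl ?zpos_pos//; exact: zavg_bad.
rewrite big_split /=; apply: lerD.
  rewrite exchange_big /= sumr_const card_ord.
  rewrite -mulr_sumr -[_ *+ nR]mulr_natl [leRHS](_ : _ = nR%:R * (2 * (2 * tail_energy AL))); last by ring.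
  by rewrite ler_wpM2l// ler_wpM2l// sum_zavg_good.
rewrite big_const_seq count_predT iter_addr_0 -[_ *+ size _]mulr_natl.
rewrite [leRHS](_ : _ = (N.-1)%:R * (2 * nR%:R * (2 ^+ nR * p ^+ (nR./2).+1 + e ^+ 2))); last first.
  by rewrite mulrAC mulrC.
rewrite ler_wpM2r ?ler_nat//; have /andP[p0 _] := p01.
by rewrite !mulr_ge0// addr_ge0 ?sqr_ge0// mulr_ge0 ?exprn_ge0// ltW.
Qed.

End averaging.

(** * The mean square error *)

Section mean_square_error.
Variables (R : realType) (d N nR : nat) (alpha : R) (gamma : nat -> R) (tau L : R).
Hypothesis prN : prime N.
Hypothesis oddR : odd nR.
Hypothesis alpha0 : 0 < alpha.
Hypothesis gamma01 : forall j, 0 < gamma j <= 1.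
Hypothesis tau0 : 0 < tau.

Let N1 : (1 < N)%N. Proof. exact: prime_gt1. Qed.
Let N0 : (0 < N)%N. Proof. exact: prime_gt0. Qed.
Let N1R : 0 < (N.-1)%:R :> R. Proof. by rewrite ltr0n -subn1 subn_gt0. Qed.
Let predN : (N%:R - 1 : R) = (N.-1)%:R.
Proof. by rewrite -[in LHS](prednK N0) -[X in X - 1]natr1 addrK. Qed.
Let lnN : 0 < ln (N%:R : R). Proof. by rewrite ln_gt0// ltr1n. Qed.

Let Q := expR tau^-1 * P_fun d alpha gamma N tau.
Let Ns := N_star d alpha gamma N tau.

Lemma P_fun_factor_ge1 j : 1 <= 1 + 2 * gamma j `^ (2 * alpha)^-1 * (1 + tau * ln N%:R).
Proof.
by rewrite lerDl !mulr_ge0 ?powR_ge0// addr_ge0// mulr_ge0// ltW.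
Qed.

Lemma P_fun_ge1 : 1 <= P_fun d alpha gamma N tau.
Proof.
rewrite /P_fun; elim/big_ind: _ => [//|x y x1 y1|j _]; last exact: P_fun_factor_ge1.
by rewrite -[1]mulr1 ler_pM.
Qed.

Lemma loss_ge1 : 1 <= Q.
Proof.
rewrite -[1]mulr1 ler_pM//; last exact: P_fun_ge1.
by rewrite -expR0 ler_expR invr_ge0 ltW.
Qed.

Let Q0 : 0 < Q. Proof. exact: lt_le_trans loss_ge1. Qed.

Lemma N_star_loss : Ns * Q = (N.-1)%:R.
Proof. by rewrite /Ns /N_star predN divfK// gt_eqF. Qed.

Lemma N_star_gt0 : 0 < Ns.
Proof. by rewrite /Ns /N_star predN divr_gt0. Qed.

Lemma N_star_le : Ns <= N%:R.
Proof.
apply: (@le_trans _ _ (N.-1)%:R); last by rewrite ler_nat leq_pred.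
by rewrite -N_star_loss ler_peMr ?loss_ge1// ltW// N_star_gt0.
Qed.

(* [P_N] contains the factor [1 + 2 gamma_j^(1/(2 alpha))], whence [|h_j| <= (N-1)/2] on [A_d(N_star)]. *)
Lemma A_set_distinct_mod h m :
  A_set d alpha gamma Ns h -> A_set d alpha gamma Ns m ->
  [forall j, (N%:Z %| tnth m j - tnth h j)%Z] -> m = h.
Proof.
move=> hA mA /forallP dvd; apply: eq_from_tnth => j; apply/eqP; rewrite -subr_eq0.
apply: contraTT isT => ne0; have := dvd j.
have hj := A_set_coord alpha0 gamma01 j (ltW N_star_gt0) hA.
have mj := A_set_coord alpha0 gamma01 j (ltW N_star_gt0) mA.
have gQ : 2 * gamma j `^ (2 * alpha)^-1 <= Q.
  apply: (@le_trans _ _ (1 + 2 * gamma j `^ (2 * alpha)^-1 * (1 + tau * ln N%:R))).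
    apply: (@le_trans _ _ (2 * gamma j `^ (2 * alpha)^-1 * (1 + tau * ln N%:R))); last by rewrite lerDr.
    by rewrite ler_peMr ?mulr_ge0 ?powR_ge0// lerDl mulr_ge0// ltW.
  rewrite -[leLHS]mul1r ler_pM//.
  - exact: le_trans ler01 (P_fun_factor_ge1 _).
  - by rewrite -expR0 ler_expR invr_ge0 ltW.
  - rewrite /P_fun (bigD1 j)//= ler_peMr ?(le_trans ler01 (P_fun_factor_ge1 _))//.
    elim/big_ind: _ => [//|x y x1 y1|i _]; last exact: P_fun_factor_ge1.
    by rewrite -[1]mulr1 ler_pM.
have small : `|(tnth m j - tnth h j)%:~R : R| < N%:R.
  apply: (@le_lt_trans _ _ (N.-1)%:R); last by rewrite ltr_nat ltn_predL.
  rewrite rmorphB; apply: le_trans (ler_normB _ _) _.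
  apply: le_trans (lerD mj hj) _; rewrite -N_star_loss.
  rewrite [leLHS](_ : _ = Ns * (2 * gamma j `^ (2 * alpha)^-1)); last by ring.
  by rewrite ler_wpM2l// ltW// N_star_gt0.
move: small; rewrite -intr_norm -[N%:R]/(N%:Z%:~R) ltr_int => small.
rewrite dvdzE /= => /dvdn_leq; rewrite absz_gt0 => /(_ ne0).
by move=> /(leq_ltn_trans); have := small; rewrite -abszE ltz_nat => s /(_ _ s); rewrite ltnn.
Qed.

(** Outside [A_d(L')] the weight exceeds [L'^(2 alpha)], while the weighted energy is at most 1. *)
Lemma tail_energy_le (K : {fset d.-tuple int}) (fh : d.-tuple int -> R[i]) (L' : R) :
  0 < L' -> \sum_(m <- K) sqn (fh m) * r_weight alpha gamma m <= 1 ->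
  tail_energy K fh (fset_set (A_set d alpha gamma L')) <= (L' `^ (2 * alpha))^-1.
Proof.
move=> L0 fK; have Lp : 0 < L' `^ (2 * alpha) by rewrite powR_gt0.
rewrite -[leRHS]mul1r ler_pdivlMr// /tail_energy mulr_suml; apply: le_trans fK.
have r0 m : 0 <= r_weight alpha gamma m := le_trans ler01 (r_weight_ge1 alpha gamma m).
rewrite [leRHS](bigID (fun m => m \in fset_set (A_set d alpha gamma L'))) /=.
rewrite -[leLHS]add0r; apply: lerD; first by apply: sumr_ge0 => m _; rewrite mulr_ge0 ?sqn_ge0.
rewrite -[leRHS]big_filter [leRHS](perm_big (K `\` fset_set (A_set d alpha gamma L'))%fset) /=; last first.
  apply: uniq_perm; rewrite ?filter_uniq ?fset_uniq//.
  by move=> m; rewrite mem_filter inE.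
rewrite big_seq [leRHS]big_seq; apply: ler_sum => m; rewrite inE => /andP[mA _].
rewrite ler_wpM2l ?sqn_ge0//; move: mA.
rewrite in_fset_set; last exact: finite_A_set (ltW L0).
by rewrite notin_setE /A_set /= => /negP; rewrite -ltNge => /ltW.
Qed.

Variable f : d.-tuple R -> R[i].
Hypothesis fK : korobov d alpha gamma f.
Hypothesis f1 : (korobov_norm alpha gamma f <= 1)%E.
Hypothesis L0 : 0 < L.
Hypothesis LN : L <= Ns.

Let A := fset_set (A_set d alpha gamma Ns).
Let AL := fset_set (A_set d alpha gamma L).
Let finA : finite_set (A_set d alpha gamma Ns).
Proof. exact: finite_A_set (ltW N_star_gt0). Qed.
Let finAL : finite_set (A_set d alpha gamma L).
Proof. exact: finite_A_set (ltW L0). Qed.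

Lemma fset_A_le (L' : R) : 0 < L' -> L' <= Ns ->
  #|` fset_set (A_set d alpha gamma L')|%:R <= (L' / Ns) * (N.-1)%:R.
Proof.
move=> L0' LN'; rewrite -N_star_loss mulrA divfK ?gt_eqF ?N_star_gt0//.
apply: card_A_set_le => //; [exact: le_trans LN' N_star_le|exact: fset_uniq|].
by move=> h; rewrite in_fset_set ?inE//; exact: finite_A_set (ltW L0').
Qed.

(** The integrand is bounded pointwise by the bounded measurable [G], whose integral is computed
    from the marginals of [Delta] and Parseval. *)
Lemma integral_draw_le (z : nR.-tuple (d.-tuple 'I_N)) (K : {fset d.-tuple int}) (e : R) :
  0 <= e -> (A `<=` K)%fset ->
  (forall x, cabs (f x - trigpoly K (fourier_coef f) x) <= e) ->
  (\int[iid (cube_unif R d) nR]_Delta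
     (L2norm (fun x => f x - A_rand alpha gamma tau z Delta f x)%R ^+ 2) <=
  (2 * (tail_energy K (fourier_coef f) A + \sum_(h <- A) \sum_(r in trusted AL z h)
     (2 * alias_energy K (fourier_coef f) (tnth z r) h + 2 * e ^+ 2)) + 2 * e ^+ 2)%:E)%E.
Proof.
move=> e0 AK fe; set fh := fourier_coef f.
pose g r h (Delta : nR.-tuple (d.-tuple (measurableTypeR R))) : R :=
  2 * sqn (trigpoly K (alias_coef fh (tnth z r) h) (tnth Delta r)) + 2 * e ^+ 2.
pose G Delta : R := 2 * (tail_energy K fh A + \sum_(h <- A) \sum_(r in trusted AL z h) g r h Delta)
  + 2 * e ^+ 2.
have bs r h : bmeas (fun Delta : nR.-tuple (d.-tuple (measurableTypeR R)) =>
    sqn (trigpoly K (alias_coef fh (tnth z r) h) (tnth Delta r))).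
  have [mt [M tM]] := bmeas_trigpoly K (alias_coef fh (tnth z r) h).
  split; last by exists M => Delta.
  by apply: (measurableT_comp mt); exact: measurable_tnth.
have bg r h : bmeas (g r h).
  by apply: bmeasD; [apply: bmeasM => //; exact: bmeas_cst|exact: bmeas_cst].
have bsum h : bmeas (fun Delta => \sum_(r in trusted AL z h) g r h Delta).
  by under eq_fun do rewrite -big_enum; exact: bmeas_sum.
have bss : bmeas (fun Delta => \sum_(h <- A) \sum_(r in trusted AL z h) g r h Delta).
  exact: bmeas_sum.
have bG : bmeas G.
  apply: bmeasD; last exact: bmeas_cst.
  by apply: bmeasM; [exact: bmeas_cst | apply: bmeasD => //; exact: bmeas_cst].
apply: (@le_trans _ _ (\int[iid (cube_unif R d) nR]_Delta (G Delta)%:E)%E).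
  apply: le_integral_nonmeasurable => Delta; first exact: expe_ge0 (Lnorm_ge0 _ _ _).
  apply: le_trans (L2norm_error_le _ _ finA AK e0 fe) _.
  rewrite lee_fin lerD2r ler_wpM2l// lerD2l big_seq [leRHS]big_seq; apply: ler_sum => h hA.
  rewrite /fhat_med; apply: le_trans (cmedian_sqn_le _ _ oddR (card_trustedC AL z h)) _.
  apply: ler_sum => r _; apply: lattice_error_le => //; first by case: fK.
  exact: (fsubsetP AK).
rewrite integral_EFin_bmeas// lee_fin le_eqVlt; apply/orP; left; apply/eqP.
rewrite RintegralD//; last 2 first.
- apply: bmeas_integrable; apply: bmeasM; first exact: bmeas_cst.
  by apply: bmeasD => //; exact: bmeas_cst.
- exact: bmeas_integrable (bmeas_cst _).
rewrite Rintegral_cst_probability; congr (_ + _).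
rewrite RintegralZl//; last by apply: bmeas_integrable; apply: bmeasD => //; exact: bmeas_cst.
congr (_ * _); rewrite RintegralD//; last 2 first.
- exact: bmeas_integrable (bmeas_cst _).
- exact: bmeas_integrable.
rewrite Rintegral_cst_probability; congr (_ + _).
rewrite Rintegral_sum_bmeas//; apply: eq_bigr => h _.
under eq_Rintegral do rewrite -big_enum.
rewrite Rintegral_sum_bmeas// big_enum /=; apply: eq_bigr => r _.
rewrite RintegralD//; last 2 first.
- by apply: bmeas_integrable; apply: bmeasM => //; exact: bmeas_cst.
- exact: bmeas_integrable (bmeas_cst _).
rewrite Rintegral_cst_probability; congr (_ + _).
rewrite RintegralZl//; last exact: bmeas_integrable.
congr (_ * _).
rewrite (Rintegral_iid_tnth (cube_unif R d) r (bmeas_trigpoly K _)).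
by rewrite parseval// fset_uniq.
Qed.

(** The three terms come from the energy outside [A_d(N_star)], the good draws and the bad
    majorities. The coefficient 3 is 2 for the tail plus 1 for the approximation of [f]; 8 and 4 are
    twice the constants of [draws_average_le]. *)
Lemma mean_square_error_le :
  (@Defs.expectation R d N nR (fun z Delta =>
     L2norm (fun x => f x - A_rand alpha gamma tau z Delta f x)%R ^+ 2) <=
   (3 * (Ns `^ (2 * alpha))^-1 + 8 * nR%:R * (L `^ (2 * alpha))^-1
    + 4 * nR%:R * (N.-1)%:R * (2 ^+ nR * (L / Ns) ^+ (nR./2).+1))%:E)%E.
Proof.
have Ns0 := N_star_gt0.
have nR0 : (0 < nR)%N by case: (nR) oddR.
have W0 : 0 < (Ns `^ (2 * alpha))^-1 by rewrite invr_gt0 powR_gt0.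
set W := (Ns `^ (2 * alpha))^-1 in W0 *.
(* Chosen so that all terms due to replacing [f] by a trigonometric polynomial add up to at most [W]. *)
pose e2 := W / (4 * nR%:R * N%:R).
have e20 : 0 < e2 by rewrite divr_gt0// !mulr_gt0// ltr0n.
pose e := Num.sqrt e2.
have e0 : 0 < e by rewrite sqrtr_gt0.
have ee : e ^+ 2 = e2 by rewrite sqr_sqrtr// ltW.
have [K [AK fe]] := korobov_trigpoly A fK e0.
set fh := fourier_coef f in fe.
have wK : \sum_(m <- K) sqn (fh m) * r_weight alpha gamma m <= 1 := korobov_sum_le K f1.
have fh1 : \sum_(m <- K) sqn (fh m) <= 1.
  apply: le_trans wK; apply: ler_sum => m _.
  by rewrite ler_peMr ?sqn_ge0// r_weight_ge1.
pose p := L / Ns.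
have p01 : 0 < p <= 1 by rewrite divr_gt0//= ler_pdivrMr// mul1r.
have ALA : (AL `<=` A)%fset.
  apply/fsubsetP => h; rewrite !in_fset_set// !inE /A_set /= => hL.
  apply: le_trans hL _; by apply: ge0_ler_powR; rewrite ?nnegrE ?(ltW L0) ?(ltW Ns0)// mulr_ge0// ltW.
have Adist h m : h \in A -> m \in A -> [forall j, (N%:Z %| tnth m j - tnth h j)%Z] -> m = h.
  by rewrite !in_fset_set// !inE; exact: A_set_distinct_mod.
have Asize : (#|` A| <= N.-1)%N.
  rewrite -(ler_nat R); apply: le_trans (fset_A_le Ns0 (lexx _)) _.
  by rewrite mulfV ?mul1r ?gt_eqF.
have ALsize : #|` AL|%:R <= p * (N.-1)%:R := fset_A_le L0 LN.
have D0 : 0 < (#|draws d N nR|%:R : R) by rewrite card_draws exprn_gt0 ?zpos_pos.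
rewrite /Defs.expectation.
pose B (z : nR.-tuple (d.-tuple 'I_N)) : R := \sum_(h <- A) \sum_(r in trusted AL z h)
     (2 * alias_energy K fh (tnth z r) h + 2 * e ^+ 2).
apply: (@le_trans _ _ ((#|draws d N nR|%:R^-1)%:E * \sum_(z in draws d N nR)
  (2 * (tail_energy K fh A + B z) + 2 * e ^+ 2)%:E)%E).
  apply: lee_wpmul2l; first by rewrite lee_fin invr_ge0 ltW.
  by apply: lee_sum => z _; apply: integral_draw_le => //; exact: ltW.
rewrite sumEFin -EFinM lee_fin.
have -> : #|draws d N nR|%:R^-1 * \sum_(z in draws d N nR) (2 * (tail_energy K fh A + B z) + 2 * e ^+ 2)
   = 2 * tail_energy K fh A + 2 * e ^+ 2 + 2 * (#|draws d N nR|%:R^-1 * \sum_(z in draws d N nR) B z).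
  rewrite (eq_bigr (fun z => (2 * tail_energy K fh A + 2 * e ^+ 2) + 2 * B z)); last first.
    by move=> z _; ring.
  rewrite big_split /= sumr_const -mulr_sumr mulrDr -[_ *+ #|_|]mulr_natl mulKf ?gt_eqF//.
  by rewrite [X in _ + X]mulrCA.
have H := draws_average_le nR prN ALA Adist Asize p01 ALsize fh1 e.
have TA := tail_energy_le Ns0 wK; have TL := tail_energy_le L0 wK.
rewrite -/A -/W in TA; rewrite -/AL in TL.
set TLv := tail_energy K fh AL in H TL; set W' := (L `^ (2 * alpha))^-1 in TL *.
rewrite -/(B _) in H.
apply: le_trans (_ : 2 * W + 2 * e2 + 2 * (4 * nR%:R * W' +
  2 * nR%:R * N.-1%:R * (2 ^+ nR * p ^+ (nR./2).+1 + e2)) <= _).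
  rewrite -ee; apply: lerD; first by rewrite lerD2r ler_wpM2l.
  rewrite ler_wpM2l//; by apply: le_trans H _; rewrite lerD2r ler_wpM2l//.
have e2W : 4 * nR%:R * N%:R * e2 = W by rewrite /e2 mulrCA mulfV ?mulr1// gt_eqF// !mulr_gt0// ltr0n.
have e2W' : 2 * e2 + 4 * nR%:R * (N.-1)%:R * e2 <= W.
  rewrite -e2W -mulrDl ler_wpM2r ?(ltW e20)//.
  have -> : (N%:R : R) = (N.-1)%:R + 1 by rewrite natr1 prednK.
  rewrite mulrDr addrC lerD2l mulr1; have : 1 <= nR%:R :> R by rewrite ler1n.
  by lra.
set X := 2 ^+ nR * _ in e2W' *.
by rewrite -subr_ge0; move: e2W'; rewrite -subr_ge0 => e2W'; apply: le_trans e2W' _;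
  rewrite le_eqVlt; apply/orP; left; apply/eqP; ring.
Qed.

End mean_square_error.

(** * The rate *)

Lemma expR_ge1 (R : realType) (x : R) : 0 <= x -> 1 <= expR x.
Proof. by move=> x0; apply: le_trans (expR_ge1Dx x); rewrite lerDl. Qed.

Section rate.
Variables (R : realType) (alpha : R) (gamma : nat -> R) (delta : R).
Hypothesis alpha0 : 0 < alpha.
Hypothesis gamma01 : forall j, 0 < gamma j <= 1.
Hypothesis delta01 : 0 < delta < 1.

Let e40 : 0 < e4 R. Proof. by rewrite mulr_gt0// expR_gt0. Qed.
Let e4_ge1 : 1 <= e4 R.
Proof. by rewrite -[1]mulr1 ler_pM// ?ler1n// expR_ge1. Qed.

Let lndelta : 0 < ln delta^-1.
Proof. by have /andP[d0 d1] := delta01; rewrite ln_gt0// invf_gt1. Qed.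

Let s : R := 1 + 2 * alpha.
Let s0 : 0 < s. Proof. by rewrite addr_gt0// mulr_gt0. Qed.

(* The ratio [L / N_star]. *)
Definition shrink : R := (4 * expR (1 + 2 * alpha))^-1.
Let t0 : 0 < shrink. Proof. by rewrite invr_gt0 mulr_gt0// expR_gt0. Qed.
Let t1 : shrink <= 1.
Proof.
rewrite invf_le1 ?mulr_gt0 ?expR_gt0// -[leLHS]mulr1 ler_pM// ?ler1n//.
by rewrite expR_ge1// ltW.
Qed.

Lemma log_term_ge (N : nat) : (1 < N)%N ->
  2 * (ln N%:R - ln (e4 R)) <= log_term delta N.
Proof.
move=> N1; have N0 : 0 < (N%:R : R) by rewrite ltr0n ltnW.
rewrite /log_term -ln_div ?posrE//; apply: (@le_trans _ _ (2 * ln (1 + (N%:R - 1) / e4 R))).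
  rewrite ler_wpM2l// ler_ln ?posrE ?divr_gt0//; last first.
    by rewrite addr_gt0// divr_gt0// subr_gt0 ltr1n.
  rewrite ler_pdivrMr// mulrDl divfK ?gt_eqF// mul1r.
  by have := e4_ge1; lra.
by rewrite lerDl mulr_ge0// ltW.
Qed.

Lemma log_term_le (N : nat) : (1 < N)%N ->
  log_term delta N <= 2 * ln N%:R + 2 * ln delta^-1.
Proof.
move=> N1; have N0 : 0 < (N%:R : R) by rewrite ltr0n ltnW.
have N10 : 0 < (N%:R - 1 : R) by rewrite subr_gt0 ltr1n.
rewrite /log_term lerD2r ler_wpM2l// ler_ln ?posrE//; last by rewrite addr_gt0// divr_gt0.
rewrite -lerBrDl ler_pdivrMr// ler_peMr// ltW//.
Qed.

(** With [nR = 2k + 1] the left side is at most [(4 shrink)^(k+1) = exp(-s (k+1))]. Since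
    [k + 1 >= nR / 2 >= ln N - ln(4e) - 1/2], this is of order [N^(-s)]. *)
Lemma majority_term_le (N nR : nat) : (1 < N)%N -> odd nR -> log_term delta N - 1 <= nR%:R ->
  2 ^+ nR * shrink ^+ (nR./2).+1 <= expR (s / 2 + s * ln (e4 R) - s * ln N%:R).
Proof.
move=> N1 oR RN; set k := nR./2.
have nRE : nR = (k.*2).+1 by rewrite -(odd_double_half nR) oR.
apply: (@le_trans _ _ (4 ^+ k.+1 * shrink ^+ k.+1)).
  rewrite ler_wpM2r ?exprn_ge0 ?(ltW t0)// nRE.
  have -> : (4 : R) = 2 ^+ 2 by rewrite -natrX.
  by rewrite -exprM; apply: ler_weXn2l; rewrite ?ler1n// mul2n doubleS.
rewrite -exprMn /shrink invfM mulrA mulfV// mul1r -expRN -expRM_natl ler_expR.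
have kR : nR%:R / 2 <= (k.+1)%:R :> R.
  by rewrite ler_pdivrMr// -natrM ler_nat nRE; lia.
rewrite mulrN.
have H := log_term_ge N1.
apply: (@le_trans _ _ (- (s * (nR%:R / 2)))).
  by rewrite lerN2 mulrC ler_wpM2r// ltW.
have -> : s / 2 + s * ln (e4 R) - s * ln N%:R = - (s * ((2 * (ln N%:R - ln (e4 R)) - 1) / 2)) by field.
by rewrite lerN2 ler_wpM2l ?(ltW s0)// ler_wpM2r ?invr_ge0//; lra.
Qed.

Definition mse_const : R :=
  3 + 8 * (shrink `^ (2 * alpha))^-1 + 4 * expR (s / 2 + s * ln (e4 R)).

Lemma mse_const_gt0 : 0 < mse_const.
Proof.
by rewrite !addr_gt0// mulr_gt0// ?invr_gt0 ?powR_gt0// expR_gt0.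
Qed.

(** With [L = shrink * N_star] the mean square error is at most [mse_const * R * N_star^(-2 alpha)].
    Its root is written as an exponential so that the rate becomes a linear inequality between
    logarithms. *)
Lemma worst_error_le (d N nR : nat) (tau : R) : prime N -> 0 < tau -> odd nR ->
  log_term delta N - 1 <= nR%:R ->
  (worst_error d alpha gamma tau N nR <=
    (expR ((ln mse_const + ln nR%:R) / 2 - alpha * ln (N_star d alpha gamma N tau)))%:E)%E.
Proof.
move=> prN tau0 oR RN; set Ns := N_star d alpha gamma N tau.
have N1 := prime_gt1 prN.
have Ns0 : 0 < Ns by exact: N_star_gt0.
have nR0 : 0 < (nR%:R : R) by rewrite ltr0n; case: (nR) oR.
have nR1 : 1 <= (nR%:R : R) by rewrite ler1n; case: (nR) oR.
have N0 : 0 < (N%:R : R) by rewrite ltr0n ltnW.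
pose W := (Ns `^ (2 * alpha))^-1.
have W0 : 0 < W by rewrite invr_gt0 powR_gt0.
have L0 : 0 < Ns * shrink by rewrite mulr_gt0.
have LNs : Ns * shrink <= Ns by rewrite ler_piMr// ltW.
have mse : 3 * W + 8 * nR%:R * ((Ns * shrink) `^ (2 * alpha))^-1
    + 4 * nR%:R * (N.-1)%:R * (2 ^+ nR * (Ns * shrink / Ns) ^+ (nR./2).+1) <= mse_const * nR%:R * W.
  rewrite powRM ?(ltW Ns0) ?(ltW t0)// invfM -/W [Ns * _]mulrC mulfK ?gt_eqF//.
  have -> : mse_const * nR%:R * W = 3 * nR%:R * W + 8 * nR%:R * (W * (shrink `^ (2 * alpha))^-1)
     + 4 * nR%:R * (expR (s / 2 + s * ln (e4 R)) * W) by rewrite /mse_const; ring.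
  apply: lerD; first apply: lerD => //.
    by rewrite ler_wpM2r ?(ltW W0)// ler_peMr.
  rewrite -[leLHS]mulrA ler_wpM2l ?mulr_ge0//.
  apply: (@le_trans _ _ (N%:R * expR (s / 2 + s * ln (e4 R) - s * ln N%:R))).
    rewrite ler_pM ?mulr_ge0 ?exprn_ge0 ?(ltW t0)//; first by rewrite ler_nat leq_pred.
    exact: majority_term_le.
  rewrite expRD mulrCA ler_wpM2l ?expR_ge0//.
  rewrite -[X in X * _ <= _]lnK ?posrE// -expRD /W -powRN /powR gt_eqF// ler_expR.
  (* The choice [s = 1 + 2 alpha] makes [N * N^(-s) = N^(-2 alpha)], which is at most
     [N_star^(-2 alpha)]. *)
  have LN : ln Ns <= ln N%:R by rewrite ler_ln ?posrE//; exact: N_star_le.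
  have -> : ln N%:R + - (s * ln N%:R) = - (2 * alpha) * ln N%:R by rewrite /s; ring.
  by rewrite !mulNr lerN2 ler_wpM2l// mulr_ge0// ltW.
have sqE : (mse_const * nR%:R * W) `^ 2^-1 =
    expR ((ln mse_const + ln nR%:R) / 2 - alpha * ln Ns).
  rewrite /powR gt_eqF ?mulr_gt0 ?mse_const_gt0//; congr expR.
  rewrite lnM ?posrE ?mulr_gt0 ?mse_const_gt0// lnM ?posrE ?mse_const_gt0//.
  by rewrite /W lnV ?posrE ?powR_gt0// ln_powR; field.
apply: ge_ereal_sup => _ [f [fK f1] <-].
rewrite /rms_error -sqE -poweR_EFin.
have E0 : (0 <= @Defs.expectation R d N nR (fun z Delta =>
     L2norm (fun x => f x - A_rand alpha gamma tau z Delta f x)%R ^+ 2))%E.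
  rewrite /Defs.expectation mule_ge0 ?lee_fin ?invr_ge0//.
  by apply: sume_ge0 => z _; apply: integral_ge0 => Delta _; exact: expe_ge0 (Lnorm_ge0 _ _ _).
have H := mean_square_error_le prN oR alpha0 gamma01 tau0 fK f1 L0 LNs.
have MW : (0 <= (mse_const * nR%:R * W)%:E)%E.
  by rewrite lee_fin !mulr_ge0 ?(ltW mse_const_gt0)// ltW.
apply: gt0_ler_poweR; rewrite ?invr_ge0 ?in_itv/= ?leey ?andbT//.
by apply: le_trans H _; rewrite lee_fin.
Qed.

(** By [1 + x <= exp x] in each factor. *)
Lemma P_fun_le_expR (d N : nat) (tau G : R) : (1 < N)%N -> 0 < tau ->
  \sum_(j < d) gamma j `^ (2 * alpha)^-1 <= G ->
  P_fun d alpha gamma N tau <= expR (2 * (1 + tau * ln N%:R) * G).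
Proof.
move=> N1 tau0 sG; have c0 : 0 <= 2 * (1 + tau * ln N%:R).
  by rewrite mulr_ge0// addr_ge0// mulr_ge0 ?(ltW tau0)// ln_ge0// ler1n ltnW.
apply: (@le_trans _ _ (expR (2 * (1 + tau * ln N%:R) * \sum_(j < d) gamma j `^ (2 * alpha)^-1))).
  rewrite mulr_sumr expR_sum; apply: ler_prod => j _; apply/andP; split.
    by apply: le_trans ler01 _; rewrite lerDl -mulrA mulrCA mulrC mulr_ge0// ?powR_ge0// mulrC.
  by rewrite mulrAC; exact: expR_ge1Dx.
by rewrite ler_expR ler_wpM2l.
Qed.

Lemma optimal_loss_le (d N : nat) (tau tau' : R) : prime N -> 0 < tau' ->
  is_tau_star alpha gamma d N tau ->
  expR tau^-1 * P_fun d alpha gamma N tau <=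
  expR (e4 R) * (expR (e4 R / tau') * P_fun d alpha gamma N tau').
Proof.
move=> prN tau'0 [[tau0 tauT] tauopt]; have N1 := prime_gt1 prN.
have lnN : 0 < ln (N%:R : R) by rewrite ln_gt0// ltr1n.
have P0 u : 0 < u -> 0 < P_fun d alpha gamma N u.
  by move=> u0; apply: lt_le_trans ltr01 _; exact: P_fun_ge1.
have e4exp u : 0 < u -> expR u^-1 <= expR (e4 R / u).
  by move=> u0; rewrite ler_expR -[leLHS]mul1r ler_wpM2r// invr_ge0 ltW.
have [tau'T|tau'T] := leP (expR (e4 R / tau') * P_fun d alpha gamma N tau')
                          (expR (- e4 R) * (N%:R - 1)).
  apply: le_trans (tauopt tau' (conj tau'0 tau'T)) _.
  apply: (@le_trans _ _ (expR (e4 R / tau') * P_fun d alpha gamma N tau')).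
    by rewrite ler_wpM2r ?(ltW (P0 _ tau'0))// e4exp.
  by rewrite ler_peMl ?mulr_ge0 ?expR_ge0 ?(ltW (P0 _ tau'0))// expR_ge1// ltW.
(* Here [tau'] lies outside [T], so [N - 1] is below the right-hand side; it bounds the left-hand
   side because [tau] lies in [T]. *)
apply: (@le_trans _ _ (N%:R - 1)).
  apply: (@le_trans _ _ (expR (e4 R / tau) * P_fun d alpha gamma N tau)).
    by rewrite ler_wpM2r ?(ltW (P0 _ tau0))// e4exp.
  apply: le_trans tauT _; rewrite ler_piMl ?subr_ge0 ?ler1n ?(ltnW N1)//.
  by rewrite expR_le1 oppr_le0 ltW.
rewrite -ler_pdivrMl ?expR_gt0// -expRN; exact: ltW.
Qed.

(** [C] and [kappa] are chosen before [d]: the dimension enters through [G] alone. *)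
Lemma rate_bound_expR (eps : R) : 0 < eps -> exists C kappa : R, 0 <= kappa /\
  forall (d : nat) (G : R), 0 < G -> \sum_(j < d) gamma j `^ (2 * alpha)^-1 <= G ->
  rate_bound alpha gamma delta d eps (expR (C + kappa * G)).
Proof.
move=> eps0.
(* The exponent [eps] is shared equally: [alpha eta = eps/2] pays for [N^eta] in the loss, and
   [(1/2 + alpha) eta' = eps/2] for the growth of [R]. *)
pose eta := eps / (2 * alpha).
pose eta' := eps / (2 * (2^-1 + alpha)).
have eta0 : 0 < eta by rewrite divr_gt0// mulr_gt0.
have eta'0 : 0 < eta' by rewrite divr_gt0// mulr_gt0// addr_gt0.
pose kappa := 2 + 2 * e4 R / eta.
pose c2 := ln (2 / eta' + 2 * ln delta^-1 + 1).
(* The [ln 2] comes from [N - 1 >= N/2], [e4] from [optimal_loss_le], and [c2] from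
   [R <= exp(c2) N^eta']. *)
exists (ln mse_const / 2 + alpha * (ln 2 + e4 R) + (2^-1 + alpha) * c2), (alpha * kappa).
split; first by rewrite mulr_ge0 ?(ltW alpha0)// addr_ge0// divr_ge0 ?(ltW eta0)// mulr_ge0// ltW.
move=> d G G0 sG Mmax _ N nR tau [[prN _] _] tauS [oR /andP[RN NR]].
have N1 := prime_gt1 prN.
have N0 : 0 < (N%:R : R) by rewrite ltr0n ltnW.
have tau0 : 0 < tau by case: tauS => -[].
have nR0 : 0 < (nR%:R : R) by rewrite ltr0n; case: (nR) oR.
have nR1 : 1 <= (nR%:R : R) by rewrite ler1n; case: (nR) oR.
apply: le_trans (worst_error_le d prN tau0 oR RN) _; rewrite lee_fin.
rewrite /powR gt_eqF ?natrM ?mulr_gt0// -expRD ler_expR lnM ?posrE//.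
set n := ln (N%:R : R); set rho := ln (nR%:R : R).
have n0 : 0 <= n by rewrite ln_ge0// ler1n ltnW.
have rho0 : 0 <= rho by rewrite ln_ge0.
set nu := ln (N_star d alpha gamma N tau).
have nuE : n - ln 2 - e4 R - kappa * G - eta * n <= nu.
  (* This [tau'] makes [2 tau' G ln N = eta ln N], while [4e/tau' + 2 G = kappa G]. *)
  pose tau' := eta / (2 * G); have tau'0 : 0 < tau' by rewrite divr_gt0// mulr_gt0.
  have Q := optimal_loss_le prN tau'0 tauS.
  have P := P_fun_le_expR N1 tau'0 sG.
  have Q' : ln (expR tau^-1 * P_fun d alpha gamma N tau) <= e4 R + kappa * G + eta * n.
    rewrite -ler_expR lnK; last first.
      by rewrite posrE mulr_gt0 ?expR_gt0// (lt_le_trans ltr01)// P_fun_ge1.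
    apply: le_trans Q _; rewrite -addrA [leRHS]expRD ler_wpM2l ?expR_ge0//.
    apply: le_trans (ler_wpM2l (expR_ge0 _) P) _; rewrite -expRD ler_expR le_eqVlt.
    apply/orP; left; apply/eqP; rewrite /tau' /kappa -/n.
    by field; rewrite !gt_eqF.
  have N10 : 0 < (N%:R - 1 : R) by rewrite subr_gt0 ltr1n.
  rewrite /nu /N_star ln_div ?posrE//; last by rewrite mulr_gt0 ?expR_gt0// (lt_le_trans ltr01)// P_fun_ge1.
  have : n - ln 2 <= ln (N%:R - 1).
    rewrite -ln_div ?posrE// ler_ln ?posrE ?divr_gt0// ler_pdivrMr//.
    have : (2 : R) <= N%:R by rewrite ler_nat.
    by lra.
  by lra.
(* [R] grows like [log N], and [n <= exp(eta' n) / eta'] absorbs the logarithm in a small power of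
   [N]. *)
have rhoE : rho <= c2 + eta' * n.
  have c20 : 0 < 2 / eta' + 2 * ln delta^-1 + 1.
    by apply: addr_gt0 => //; apply: addr_gt0; [exact: divr_gt0|exact: mulr_gt0].
  rewrite -ler_expR lnK ?posrE// expRD lnK ?posrE//.
  have en1 : 1 <= expR (eta' * n) by rewrite expR_ge1// mulr_ge0// ltW.
  have en2 : n <= expR (eta' * n) / eta'.
    rewrite ler_pdivlMr// mulrC; apply: le_trans (expR_ge1Dx _); by rewrite lerDr.
  apply: le_trans NR _; apply: le_trans (_ : 2 * n + 2 * ln delta^-1 + 1 <= _).
    by rewrite lerD2r log_term_le.
  have -> : (2 / eta' + 2 * ln delta^-1 + 1) * expR (eta' * n) =
      2 * (expR (eta' * n) / eta') + (2 * ln delta^-1 + 1) * expR (eta' * n).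
    by field; rewrite gt_eqF.
  rewrite -[leLHS]addrA; apply: lerD; first by rewrite ler_wpM2l.
  by rewrite ler_peMr// addr_ge0// mulr_ge0// ltW.
have H1 : - (alpha * nu) <= - (alpha * (n - ln 2 - e4 R - kappa * G - eta * n)).
  by rewrite lerN2 ler_wpM2l// ltW.
(* The factor [R^(1/2)] of the error and [R^(-alpha)] of the claimed rate combine to
   [R^(1/2 + alpha)]. *)
have H2 : (2^-1 + alpha) * rho <= (2^-1 + alpha) * (c2 + eta' * n).
  by rewrite ler_wpM2l// addr_ge0// ltW.
have E1 : alpha * (eta * n) = eps / 2 * n by rewrite /eta; field; rewrite gt_eqF.
have E2 : (2^-1 + alpha) * (eta' * n) = eps / 2 * n.
  by rewrite /eta'; field; rewrite gt_eqF// addr_gt0// mulr_gt0.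
have er : 0 <= eps * rho by rewrite mulr_ge0// ltW.
have rest : 0 <= 2^-1 * rho by rewrite mulr_ge0.
clearbody kappa c2 n rho nu.
by lra.
Qed.

End rate.

(** * Dependence of the constant on the dimension *)

Lemma le_rate_bound (R : realType) (alpha : R) (gamma : nat -> R) (delta : R) (d : nat)
    (eps C C' : R) : C <= C' ->
  rate_bound alpha gamma delta d eps C -> rate_bound alpha gamma delta d eps C'.
Proof.
move=> CC' HC Mmax adm N nR tau isN isT isR.
by apply: le_trans (HC Mmax adm N nR tau isN isT isR) _; rewrite lee_fin ler_wpM2r ?powR_ge0.
Qed.

(** The limit superior is an infimum of suprema over neighbourhoods of infinity, so one of these
    suprema is below [+oo]. The maximum with 0 makes [K] nonnegative. *)
Lemma limn_esup_lty_bound (R : realType) (u : nat -> R) :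
  (limn_esup (fun n => (u n)%:E) < +oo)%E ->
  exists2 K : R, 0 <= K & exists n0, forall n, (n0 <= n)%N -> u n <= K.
Proof.
move=> /ereal_inf_lt[_ [V [n0 _ n0V] <-] Voo].
set sV := ereal_sup _ in Voo.
exists (Num.max (fine sV) 0); first by rewrite le_max lexx orbT.
exists n0 => n n0n; have : ((u n)%:E <= sV)%E.
  by apply: ereal_sup_ubound; exists n => //; exact: n0V.
by case: sV Voo => [r| |]// _; rewrite lee_fin le_max => ->.
Qed.
Theorem mainTheorem4 (R : realType) (alpha : R) (gamma : nat -> R) (delta : R)
    (halpha : 2^-1 < alpha)
    (hgamma_pos : forall j : nat, 0 < gamma j)
    (hgamma_le1 : gamma 0%N <= 1)
    (hgamma_noninc : forall j : nat, gamma j.+1 <= gamma j)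
    (hdelta : 0 < delta < 1) :
  [/\ (forall d : nat, (0 < d)%N -> forall eps : R, 0 < eps ->
         exists C : R, rate_bound alpha gamma delta d eps C),
      ((\sum_(0 <= j <oo) (gamma j `^ (2 * alpha)^-1)%:E < +oo)%E ->
         forall eps : R, 0 < eps ->
         exists C : R, forall d : nat, (0 < d)%N ->
           rate_bound alpha gamma delta d eps C)
    & ((limn_esup (fun d : nat =>
           ((\sum_(j < d) gamma j `^ (2 * alpha)^-1) / ln d%:R)%:E)
          < +oo)%E ->
         forall eps : R, 0 < eps ->
         exists (C : R) (q : nat), forall d : nat, (0 < d)%N ->
           rate_bound alpha gamma delta d eps (C * d%:R ^+ q))].
Proof.
have alpha0 : 0 < alpha by apply: lt_trans halpha; rewrite invr_gt0.
have gamma01 j : 0 < gamma j <= 1.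
  by rewrite hgamma_pos; elim: j => [//|j IH]; exact: le_trans (hgamma_noninc j) IH.
have g0 j : 0 <= gamma j `^ (2 * alpha)^-1 by exact: powR_ge0.
split.
- move=> d d0 eps eps0; have [C [kappa [kappa0 HC]]] := rate_bound_expR alpha0 gamma01 hdelta eps0.
  (* The added 1 makes [G] positive, as it does for the summable weights. *)
  exists (expR (C + kappa * (\sum_(j < d) gamma j `^ (2 * alpha)^-1 + 1))).
  by apply: HC; rewrite ?lerDl// ltr_wpDl// sumr_ge0.
- move=> Soo eps eps0; have [C [kappa [kappa0 HC]]] := rate_bound_expR alpha0 gamma01 hdelta eps0.
  set S := (\sum_(0 <= j <oo) _)%E in Soo.
  have S0 : (0 <= S)%E by apply: nneseries_ge0 => j _ _; rewrite lee_fin.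
  have Sfin : S \is a fin_num by rewrite ge0_fin_numE.
  exists (expR (C + kappa * (fine S + 1))) => d d0; apply: HC.
    by rewrite ltr_wpDl// fine_ge0.
  apply: (@le_trans _ _ (fine S)); last by rewrite lerDl.
  rewrite -lee_fin fineK// -sumEFin -(big_mkord xpredT (fun j => (gamma j `^ (2 * alpha)^-1)%:E)).
  by apply: nneseries_lim_ge => j _ _; rewrite lee_fin.
- move=> /limn_esup_lty_bound[K K0 [n0 HK]] eps eps0.
  have [C [kappa [kappa0 HC]]] := rate_bound_expR alpha0 gamma01 hdelta eps0.
  (* An integer above [kappa K], so that [exp(kappa K ln d) <= d^q]. *)
  pose q := (Num.truncn (kappa * K)).+1.
  exists (expR (C + kappa * (n0%:R + 2))), q => d d0.
  have d0R : 0 < (d%:R : R) by rewrite ltr0n.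
  have lnd : 0 <= ln (d%:R : R) by rewrite ln_ge0// ler1n.
  (* [G = K ln d + n0 + 2] covers all [d]: below [n0 + 2] the sum of weights is at most [d], and
     from there on [d >= 2], so [ln d > 0] and the bound on the quotient may be multiplied out. *)
  apply: (@le_rate_bound _ _ _ _ _ _ (expR (C + kappa * (K * ln d%:R + (n0%:R + 2))))).
    rewrite mulrDr addrCA addrC [leLHS]expRD ler_wpM2l ?expR_ge0//.
    rewrite -[d%:R in leRHS]lnK ?posrE// -expRM_natl ler_expR mulrA ler_wpM2r//.
    by rewrite ltW// truncnS_gt.
  apply: HC; first by rewrite ltr_wpDl ?mulr_ge0// ltr_wpDl.
  have sum_le_d : \sum_(j < d) gamma j `^ (2 * alpha)^-1 <= d%:R.
    rewrite -[d in leRHS]card_ord -sumr_const; apply: ler_sum => j _.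
    exact: weight_root_le1.
  have [dn|nd] := ltnP d (n0 + 2).
    apply: le_trans sum_le_d _; rewrite -[leLHS]add0r; apply: lerD; first exact: mulr_ge0.
    by rewrite -natrD ler_nat ltnW.
  have lnd0 : 0 < ln (d%:R : R) by rewrite ln_gt0// ltr1n (leq_trans _ nd)// addn2.
  have := HK d (leq_trans (leq_addr _ _) nd).
  rewrite ler_pdivrMr// => H; apply: le_trans H _; rewrite lerDl.
  by rewrite addr_ge0.
Qed.
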